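(* $$\int_0^\infty e^{a^2t}f(t)\operatorname{erfc}(a\sqrt{t})\,dt=\frac{2}{\pi}\int_0^{\pi/2}F(a^2\tan^2(\theta))\,d\theta=\frac{2a}{\pi}\int_a^\infty\frac{F(s^2)}{s^2+a^2}\,ds,$$ where $F(s)=(\mathcal{L}f)(s)$ is the Laplace transform of $f(t)$.
   Context: The Laplace transform of $f$ is $F(s)=(\mathcal{L}f)(s)=\int_0^\infty f(t)e^{-st}\,dt$. The complementary error function is $\operatorname{erfc}(x)=1-\operatorname{erf}(x)$, where $\operatorname{erf}(x)=\frac{2}{\sqrt{\pi}}\int_0^x e^{-u^2}\,du$ is the error function.
   Formalization: The lower limit a of the last integral is corrected to 0 (the printed equality fails, e.g. for f(t)=e^{-t}); a is taken real and positive, f real-valued, and the left-hand integral is assumed to converge. *)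

(* Defs.v *)
From mathcomp Require Import all_boot all_order all_algebra.
From mathcomp Require Import all_classical all_reals all_analysis.

Set Implicit Arguments.
Unset Strict Implicit.
Unset Printing Implicit Defensive.

Import Order.TTheory GRing.Theory Num.Theory.
Import numFieldNormedType.Exports.

Local Open Scope classical_set_scope.
Local Open Scope ring_scope.

Section improper_integral.
Context {R : realType}.
Implicit Types (F G : set_system R) (g : R -> R).

(* Improper integrals are limits of Lebesgue integrals over compact intervals
   [x, y], where x follows F (the lower end) and y independently follows G (the
   upper end).  Conditional convergence is allowed at both ends: for instance
   sin t / t has an improper integral over (0, +oo) although it is not
   integrable there.  F is meant to lie below G. *)
Definition compact_integral g (p : R * R) : R :=
  \int[@lebesgue_measure R]_(t in `[p.1, p.2]) g t.

Definition improper_integrable F G g : Prop :=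
  (\forall p \near filter_prod F G,
     (@lebesgue_measure R).-integrable `[p.1, p.2] (EFin \o g)) /\
  cvg (compact_integral g p @[p --> filter_prod F G]).

(* Meaningful only when improper_integrable F G g holds. *)
Definition improper_integral F G g : R :=
  lim (compact_integral g p @[p --> filter_prod F G]).

Definition laplace (f : R -> R) (s : R) : R :=
  improper_integral 0^'+ +oo (fun t => f t * expR (- (s * t))).

(* For x < 0 the integral from 0 to x is oriented. *)
Definition erf (x : R) : R :=
  2 / Num.sqrt pi *
  (if 0 <= x then \int[@lebesgue_measure R]_(u in `[0, x]) expR (- u ^+ 2)
   else - \int[@lebesgue_measure R]_(u in `[x, 0]) expR (- u ^+ 2)).

Definition erfc (x : R) : R := 1 - erf x.

End improper_integral.

(* Main.v *)
Require Import Defs.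
From mathcomp Require Import all_boot all_order all_algebra.
From mathcomp Require Import all_classical all_reals all_analysis.
From mathcomp Require Import measurable_realfun ring lra.

Import Order.TTheory GRing.Theory Num.Theory.
Import numFieldNormedType.Exports.

Local Open Scope classical_set_scope.
Local Open Scope ring_scope.

(** Let W t be the integral of a / (s^2 + a^2) * exp (- s^2 t) over s >= 0.
    The Gauss integral gives W t = pi / 2 * exp (a^2 t) * erfc (a sqrt t)
    (cauchy_gauss_erfc), so that the integral on the left of the formula is,
    up to the factor pi / 2, the integral of h = f W.  Writing W as an integral
    and exchanging the two integrations produces the integral of F (s^2) against
    the weight a / (s^2 + a^2), and s = a tan theta relates the two integrals
    on the right.

    The difficulty is that the integral of h may converge only conditionally,
    so that Fubini's theorem applies on compact rectangles only.  The remaining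
    tails are controlled by a second mean value estimate
    (quasi_concave_second_mean_value): if all the integrals of h over
    subintervals of [x, y] are at most e in absolute value, and g is
    quasi-concave with values in [0, M], then the integral of h g over [x, y]
    is at most M e in absolute value.  Indeed that integral is the integral over
    the levels l in [0, M] of the integral of h over {g > l}, which is an
    interval.  The estimate is used with two families of functions.

    - exp (- c t) / W t is the inverse of exp (c t) W t, a superposition of
      exponentials of t, hence a convex function.  It is therefore quasi-concave,
      and it is bounded uniformly in c >= q^2 for each q > 0.  As
      f t * exp (- c t) is h t times this function, the Laplace integral
      converges for every c > 0, uniformly on [q^2, +oo[, and its sum is
      continuous (laplace_approx, laplace_continuous).

    - The part of W t that comes from s <= q, divided by W t, lies in [0, 1] and
      is nondecreasing in t, because a larger t favours the small values of s
      (lower_ratio_nondecreasing).  By the uniform convergence just mentioned,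
      the integral over [p, q] of F (s^2) against the weight is the limit of the
      integrals over [x, y] of h multiplied by the difference of two such
      ratios.  This difference tends to 1 uniformly on compact sets as p
      tends to 0 and q to infinity, and the estimate bounds the contribution of
      the tails of h independently of p and q (stieltjes_approx). *)

(** * Exchanging two integrals against a bounded kernel *)

Section integrable_mul.
Context {d} {T : measurableType d} {R : realType}.
Variable m : {measure set T -> \bar R}.

Lemma integrable_mul_bounded (D : set T) (f g : T -> R) (M : R) :
  measurable D -> m.-integrable D (EFin \o f) -> measurable_fun D g ->
  (forall x, D x -> `|g x| <= M) ->
  m.-integrable D (EFin \o (fun x => f x * g x)).
Proof.
move=> mD fi mg gM.
apply: (@integrableMl _ _ _ m D mD (EFin \o f) g fi mg).
exists M; split; first exact: num_real.
by move=> N MN x Dx; exact: le_trans (gM x Dx) (ltW MN).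
Qed.

Lemma integrable_patchT (D : set T) (f : T -> R) : measurable D ->
  m.-integrable D (EFin \o f) -> m.-integrable setT (EFin \o (f \_ D)).
Proof. by move=> mD; rewrite -restrict_EFin; move/(integrable_mkcond _ mD). Qed.

(** Turns the explicit values of improper integrals of nonnegative functions into
    integrability. *)
Lemma integrable_ge0_fin (D : set T) (f : T -> R) (r : R) :
  measurable D -> measurable_fun D f -> (forall x, D x -> 0 <= f x) ->
  (\int[m]_(x in D) (f x)%:E = r%:E)%E -> m.-integrable D (EFin \o f).
Proof.
move=> mD mf f0 fr; apply/integrableP; split; first exact/measurable_EFinP.
rewrite (eq_integral (fun x => (f x)%:E)) ?fr ?ltry// => x; rewrite inE => Dx /=.
by rewrite ger0_norm// f0.
Qed.

Lemma integrableB_EFin (D : set T) (f g : T -> R) : measurable D ->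
  m.-integrable D (EFin \o f) -> m.-integrable D (EFin \o g) ->
  m.-integrable D (EFin \o (fun x => f x - g x)).
Proof.
by move=> mD fi gi; apply: eq_integrable (integrableB mD fi gi).
Qed.

End integrable_mul.

Section bounded_kernel.
Context {d1 d2} {T1 : measurableType d1} {T2 : measurableType d2} {R : realType}.
Variables (m1 : {sigma_finite_measure set T1 -> \bar R})
          (m2 : {sigma_finite_measure set T2 -> \bar R}).
Variables (A : set T1) (B : set T2) (f : T1 -> R) (g : T2 -> R).
Variables (K : T1 * T2 -> R) (M : R).
Hypotheses (mA : measurable A) (mB : measurable B)
  (fi : m1.-integrable A (EFin \o f)) (gi : m2.-integrable B (EFin \o g))
  (mK : measurable_fun [set: T1 * T2] K)
  (KM : forall x y, A x -> B y -> `|K (x, y)| <= M).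

Lemma integrable_bounded_kernel : (m1 \x m2)%E.-integrable setT
  (fun z => ((f \_ A) z.1 * (g \_ B) z.2 * K z)%:E).
Proof.
set phi := (X in integrable _ _ X).
have /integrableP[/measurable_EFinP mf fAi] := integrable_patchT m1 _ _ mA fi.
have /integrableP[/measurable_EFinP mg gBi] := integrable_patchT m2 _ _ mB gi.
have mphi : measurable_fun setT phi.
  apply/measurable_EFinP; apply: measurable_funM => //.
  by apply: measurable_funM; apply: measurableT_comp.
apply/integrable12ltyP => //.
have mgB : measurable_fun setT (fun y => `|((g \_ B) y)%:E|%E).
  by apply: measurableT_comp => //; exact/measurable_EFinP.
have mfA : measurable_fun setT (fun x => `|((f \_ A) x)%:E|%E).
  by apply: measurableT_comp => //; exact/measurable_EFinP.
pose C : \bar R := (`|M|%:E * \int[m2]_y `|((g \_ B) y)%:E|)%E.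
have C0 : (0 <= C)%E by rewrite mule_ge0// ?integral_ge0// lee_fin.
have Cy : (C < +oo)%E by rewrite /C lte_mul_pinfty// lee_fin.
apply: (@le_lt_trans _ _ (\int[m1]_x (C * `|((f \_ A) x)%:E|))%E).
  apply: ge0_le_integral => //.
  - by move=> x _; exact: integral_ge0.
  - apply: (measurable_fun_fubini_tonelli_F (abse \o phi)) => //=.
    exact: measurableT_comp.
  - exact: measurable_funeM.
  move=> x _; rewrite /C -ge0_integralZl//.
  rewrite -ge0_integralZr//; last exact: measurable_funeM.
  apply: ge0_le_integral => //.
  - by apply: measurableT_comp => //; apply: measurableT_comp.
  - apply: emeasurable_funM => //; exact: measurable_funeM.
  move=> y _; rewrite /phi/= -!EFinM lee_fin !patchE.
  case: ifPn => xA; last by rewrite !mul0r normr0 mulr0.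
  case: ifPn => yB; last by rewrite mulr0 mul0r normr0 mulr0 mul0r.
  rewrite !normrM [leLHS]mulrC -[leRHS]mulrA [X in _ <= _ * X]mulrC.
  rewrite ler_wpM2r// ?mulr_ge0//.
  by rewrite (le_trans (KM _ _ (set_mem xA) (set_mem yB)))// ler_norm.
by rewrite ge0_integralZl// lte_mul_pinfty// ge0_fin_numE.
Qed.

(** Extending the integrand by 0 turns integrals over A and B into integrals over
    whole spaces, where the product measure lives. *)
Lemma Rintegral_kernel_patch x :
  (\int[m2]_y ((f \_ A) x * (g \_ B) y * K (x, y))%:E =
   (((fun x => f x * \int[m2]_(y in B) (g y * K (x, y))) \_ A) x)%:E)%E.
Proof.
rewrite !patchE; case: ifPn => [|_]; last first.
  by rewrite integral0_eq// => y _; rewrite !mul0r.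
rewrite inE => Ax.
have iK : m2.-integrable B (EFin \o (fun y => g y * K (x, y))).
  apply: (integrable_mul_bounded m2 _ _ _ M) => //.
    by apply: measurable_funTS; apply: measurableT_comp.
  by move=> y By; exact: KM.
rewrite -RintegralZl// fineK; last first.
  by apply: integrable_fin_num => //; apply: (integrableZl mB (f x) iK).
rewrite [RHS]integral_mkcond; apply: eq_integral => y _.
rewrite !patchE; case: ifPn => yB; first by rewrite mulrA.
by rewrite mulr0 mul0r.
Qed.

Lemma integrable_Rintegral_kernel :
  m1.-integrable A (EFin \o (fun x => f x * \int[m2]_(y in B) (g y * K (x, y)))).
Proof.
apply/(integrable_mkcond _ mA); rewrite restrict_EFin.
rewrite (_ : _ \o _ = fubini_F m2
  (fun z => ((f \_ A) z.1 * (g \_ B) z.2 * K z)%:E)); last first.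
  by apply/funext => x /=; rewrite -Rintegral_kernel_patch.
exact/integrable_fubini_F/integrable_bounded_kernel.
Qed.

End bounded_kernel.

(** The form of Fubini's theorem needed below: the absolute integrability on the
    product comes for free from that of the two one-variable factors, since the
    kernel that couples them is bounded. *)
Lemma Rintegral_bounded_kernel_swap {d1 d2} {T1 : measurableType d1}
    {T2 : measurableType d2} {R : realType}
    (m1 : {sigma_finite_measure set T1 -> \bar R})
    (m2 : {sigma_finite_measure set T2 -> \bar R})
    (A : set T1) (B : set T2) (f : T1 -> R) (g : T2 -> R)
    (K : T1 * T2 -> R) (M : R) :
  measurable A -> measurable B ->
  m1.-integrable A (EFin \o f) -> m2.-integrable B (EFin \o g) ->
  measurable_fun [set: T1 * T2] K ->
  (forall x y, A x -> B y -> `|K (x, y)| <= M) ->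
  \int[m1]_(x in A) (f x * \int[m2]_(y in B) (g y * K (x, y))) =
  \int[m2]_(y in B) (g y * \int[m1]_(x in A) (f x * K (x, y))).
Proof.
move=> mA mB fi gi mK KM.
rewrite Rintegral_mkcond [RHS]Rintegral_mkcond /Rintegral; congr fine.
under eq_integral do
  rewrite -(Rintegral_kernel_patch _ _ _ _ _ _ _ mB gi mK KM).
pose sw (z : T2 * T1) := (z.2, z.1).
have mK' : measurable_fun setT (K \o sw).
  by apply: measurableT_comp => //; exact: measurable_swap.
under [RHS]eq_integral do rewrite -(Rintegral_kernel_patch m1 B A g f
  (K \o sw) M mA fi mK' (fun y x By Ax => KM x y Ax By)).
rewrite (Fubini (integrable_bounded_kernel m1 m2 A B f g K M mA mB fi gi mK KM)).
by apply: eq_integral => y _; apply: eq_integral => x _ /=; rewrite [_ * (f \_ _) _]mulrC.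
Qed.

(** * A second mean value estimate for quasi-concave factors *)

Section second_mean_value.
Context {R : realType}.
Local Notation mu := (@lebesgue_measure R).
Implicit Types (g h : R -> R) (x y z u v t c e M : R).

Lemma integrable_itv_sub {h x y} u v : mu.-integrable `[x, y] (EFin \o h) ->
  x <= u -> v <= y -> mu.-integrable `[u, v] (EFin \o h).
Proof.
move=> hi xu vy; apply: (integrableS _ _ _ hi) => //.
by move=> t /=; rewrite !in_itv/= => /andP[ut tv]; rewrite (le_trans xu)// (le_trans tv).
Qed.

Lemma integrable_itv_cst c x y : mu.-integrable `[x, y] (EFin \o (fun=> c)).
Proof.
apply: continuous_compact_integrable; first exact: segment_compact.
by apply: continuous_subspaceT => ?; exact: cvg_cst.
Qed.

Lemma Rintegral_itv_cst c x y : x <= y -> \int[mu]_(t in `[x, y]) c = c * (y - x).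
Proof.
move=> xy; rewrite Rintegral_cst//= lebesgue_measure_itv/= lte_fin.
case: ltrP => //= yx; congr (_ * _).
by apply/esym/eqP; rewrite subr_eq0 eq_le xy yx.
Qed.

Lemma normr_Rintegral_itv_le h x y M : x <= y ->
  mu.-integrable `[x, y] (EFin \o h) ->
  (forall t, x <= t -> t <= y -> `|h t| <= M) ->
  `|\int[mu]_(t in `[x, y]) h t| <= M * (y - x).
Proof.
move=> xy hi hM; rewrite (le_trans (le_normr_Rintegral _ hi))//.
rewrite -Rintegral_itv_cst//; apply: le_Rintegral => //.
- exact: integrable_norm hi.
- exact: integrable_itv_cst.
- by move=> t /=; rewrite in_itv/= => /andP[xt ty]; exact: hM.
Qed.

Lemma Rintegral_itv_cat h x y z : x <= y -> y <= z ->
  mu.-integrable `[x, z] (EFin \o h) ->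
  \int[mu]_(t in `[x, z]) h t =
  \int[mu]_(t in `[x, y]) h t + \int[mu]_(t in `[y, z]) h t.
Proof.
move=> xy yz hi; apply/eqP; rewrite addrC -subr_eq; apply/eqP.
rewrite (@Rintegral_itvB _ _ _ _ y hi) ?bnd_simp//.
apply: Rintegral_itv_obnd_cbnd; apply: (integrableS _ _ _ hi) => //.
by move=> t /=; rewrite !in_itv/= => /andP[/ltW yt ->]; rewrite (le_trans xy).
Qed.

(** Endpoints have measure zero, so that a bound on the integrals over the closed
    subintervals extends to arbitrary subintervals. *)
Lemma normr_Rintegral_interval_le h x y e (J : set R) :
  mu.-integrable `[x, y] (EFin \o h) -> 0 <= e ->
  (forall u v, x <= u -> u <= v -> v <= y ->
    `|\int[mu]_(t in `[u, v]) h t| <= e) ->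
  is_interval J -> J `<=` `[x, y] -> `|\int[mu]_(t in J) h t| <= e.
Proof.
move=> hi e0 he iJ Jxy.
have [->|J0] := eqVneq J set0; first by rewrite Rintegral_set0 normr0.
have {}J0 : J !=set0 by apply/set0P.
have lJ : lbound J x by move=> t /Jxy/=; rewrite in_itv/= => /andP[].
have uJ : ubound J y by move=> t /Jxy/=; rewrite in_itv/= => /andP[].
have hlJ : has_lbound J by exists x.
have huJ : has_ubound J by exists y.
have xi : x <= inf J by exact: lb_le_inf.
have sy : sup J <= y by exact: ge_sup.
have is_ : inf J <= sup J.
  by case: J0 => t Jt; rewrite (le_trans (ge_inf hlJ Jt))// ub_le_sup.
suff <- : \int[mu]_(t in `[inf J, sup J]) h t = \int[mu]_(t in J) h t.
  exact: he.
have Jcc b1 b2 : mu.-integrable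
    [set` Interval (BSide b1 (inf J)) (BSide b2 (sup J))] (EFin \o h).
  apply: (integrableS _ _ _ hi) => // t /=.
  rewrite in_itv/= => /andP[it ts]; rewrite in_itv/=.
  rewrite (le_trans xi) ?(le_trans _ sy)//.
  by case: b2 ts => //= /ltW.
  by case: b1 it => //= /ltW.
rewrite {3}((is_intervalP _).1 iJ) /Rhull (asboolT hlJ) (asboolT huJ).
case: `[< J (inf J) >]; case: `[< J (sup J) >] => /=.
- by [].
- by rewrite -Rintegral_itv_bndo_bndc.
- by rewrite -Rintegral_itv_obnd_cbnd.
- by rewrite -Rintegral_itv_bndo_bndc// -Rintegral_itv_obnd_cbnd.
Qed.

Definition quasi_concave x y g := forall u t v,
  x <= u -> u <= t -> t <= v -> v <= y -> Num.min (g u) (g v) <= g t.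

Lemma nondecreasing_quasi_concave x y g :
  (forall u v, x <= u -> u <= v -> v <= y -> g u <= g v) -> quasi_concave x y g.
Proof.
move=> gn u t v xu ut tv vy.
by rewrite ge_min gn// (le_trans tv).
Qed.

(** The preimages of the half-lines [r, +oo[ are intervals. *)
Lemma quasi_concave_measurable x y g : quasi_concave x y g ->
  measurable_fun `[x, y] g.
Proof.
move=> qg.
apply: (measurability (@RGenCInfty.G R)) => [|/= _ [_] [r] -> <-].
  exact: RGenCInfty.measurableE.
apply: is_interval_measurable => s t/=.
rewrite !in_itv/= !andbT => -[/andP[xs sy] fs] [/andP[xt ty] ft] u /andP[su ut].
split; first by rewrite /= in_itv/= (le_trans xs su) (le_trans ut ty).
by rewrite /= in_itv/= andbT (le_trans _ (qg _ _ _ xs su ut ty))// le_min fs.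
Qed.

(** A variant of the second mean value theorem.  For t in [x, y], g t is the
    integral over the levels l in [0, M] of the indicator of l < g t; after
    exchanging the integrals, each level contributes the integral of h over
    {g > l}, an interval by quasi-concavity. *)
Lemma quasi_concave_second_mean_value x y h g M e :
  mu.-integrable `[x, y] (EFin \o h) ->
  quasi_concave x y g -> (forall t, x <= t -> t <= y -> 0 <= g t <= M) ->
  0 <= M -> 0 <= e ->
  (forall u v, x <= u -> u <= v -> v <= y ->
    `|\int[mu]_(t in `[u, v]) h t| <= e) ->
  `|\int[mu]_(t in `[x, y]) (h t * g t)| <= M * e.
Proof.
move=> hi qg gM M0 e0 he.
pose swp (z : R * R) := (z.2, z.1).
pose K (z : R * R) : R := (z.2 < (g \_ `[x, y]) z.1)%R%:R.
have mg : measurable_fun setT (g \_ `[x, y]).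
  by apply/(measurable_restrictT g (measurable_itv _)); exact: quasi_concave_measurable.
have mK : measurable_fun setT K.
  apply: (@measurableT_comp _ _ _ _ _ _ (fun b : bool => b%:R : R)) => //.
  apply: measurable_fun_ltr; first exact: measurable_snd.
  by apply: measurableT_comp.
have K1 s t : `[x, y]%classic s -> `[0, M]%classic t -> `|K (s, t)| <= 1.
  by move=> _ _; rewrite /K; case: (_ < _)%R; rewrite ?normr1 ?normr0.
have i1 := integrable_itv_cst 1 0 M.
have layer t : `[x, y]%classic t ->
    \int[mu]_(l in `[0, M]) (1 * K (t, l)) = g t.
  move=> txy; have := txy; rewrite /= in_itv/= => /andP[xt ty].
  have /andP[g0 gtM] := gM _ xt ty.
  transitivity (\int[mu]_(l in `[0, M] `&` `[0, g t[) 1).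
    rewrite Rintegral_mkcondr; apply: eq_Rintegral => l; rewrite inE/= in_itv/=.
    move=> /andP[l0 lM]; rewrite mul1r /K/= !patchE mem_set//.
    rewrite mem_setE in_itv/= l0/=; by case: (_ < _)%R.
  rewrite (_ : _ `&` _ = `[0, g t[%classic); last first.
    apply/seteqP; split => l/=; rewrite !in_itv/=; first by case.
    by move=> /andP[-> lg]; rewrite lg (le_trans (ltW lg)).
  rewrite Rintegral_cst// mul1r /= lebesgue_measure_itv/= lte_fin.
  by case: ltrP => //=; rewrite ?subr0// => gt0; apply/esym/le_anti; rewrite g0 gt0.
have -> : \int[mu]_(t in `[x, y]) (h t * g t) =
    \int[mu]_(l in `[0, M]) (1 * \int[mu]_(t in `[x, y]) (h t * K (t, l))).
  rewrite -(Rintegral_bounded_kernel_swap mu mu _ _ _ _ _ 1 _ _ hi i1 mK K1)//.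
  by apply: eq_Rintegral => t; rewrite inE => txy; rewrite layer.
have K1' t l : `[0, M]%classic t -> `[x, y]%classic l -> `|(K \o swp) (t, l)| <= 1.
  by move=> ? ?; exact: K1.
have mK' : measurable_fun setT (K \o swp).
  by apply: measurableT_comp => //; exact: measurable_swap.
have iF := integrable_Rintegral_kernel mu mu `[0, M] `[x, y] _ _ _ 1
  (measurable_itv _) (measurable_itv _) i1 hi mK' K1'.
rewrite mulrC -[M in leRHS]subr0; apply: normr_Rintegral_itv_le => //.
move=> l l0 lM; rewrite mul1r.
rewrite (_ : \int[mu]_(t in _) _ = 
  \int[mu]_(t in `[x, y] `&` [set t | l < g t]) h t).
  apply: (normr_Rintegral_interval_le _ x y e) => //.
  move=> s t [/= ] /[!in_itv]/= /andP[xs sy] ls [/andP[xt ty] lt] u /andP[su ut].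
  split; first by rewrite /= in_itv/= (le_trans xs su) (le_trans ut ty).
  by rewrite /= (lt_le_trans _ (qg _ _ _ xs su ut ty))// lt_min ls.
rewrite Rintegral_mkcondr; apply: eq_Rintegral => t txy.
rewrite /K/= !patchE txy; case: ifPn => [|/negP].
  by rewrite inE/= => ->; rewrite mulr1.
by rewrite inE/= => /negP/negbTE ->; rewrite mulr0.
Qed.
End second_mean_value.

(** * Conditionally convergent integrals on the half line *)

Section improper_half_line.
Context {R : realType}.
Local Notation mu := (@lebesgue_measure R).
Implicit Types (g : R -> R) (x y u v d T e L : R).

(** The two ends are free to move independently, hence the separate thresholds d
    and T. *)
Lemma near_0yP (P : R * R -> Prop) :
  (\forall p \near filter_prod (0 : R)^'+ +oo, P p) <->
  exists d T, 0 < d /\ forall x y, 0 < x -> x <= d -> T <= y -> P (x, y).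
Proof.
split=> [[[A B]/= [A0 By] AB]|[d [T [d0 dT]]]].
- have [d /= d0 dA] := A0.
  have [T [_ TB]] := By.
  exists (d / 2), (T + 1); split=> [|x y x0 xd Ty]; first by rewrite divr_gt0.
  apply: (AB (x, y)); split => /=.
    apply: dA => //=; rewrite sub0r normrN gtr0_norm// (le_lt_trans xd)//.
    by rewrite ltr_pdivrMr// ltr_pMr// ltr1n.
  by apply: TB; rewrite (lt_le_trans _ Ty)// ltrDl.
- exists ([set x | 0 < x <= d], [set y | T <= y]) => /=.
    split; near=> z => /=.
      by apply/andP; split; near: z; [exact: nbhs_right_gt|exact: nbhs_right_le].
    by near: z; apply: nbhs_pinfty_ge; exact: num_real.
  by move=> [x y] /= [/andP[x0 xd] Ty]; exact: dT.
Unshelve. all: by end_near. Qed.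

(** A quantitative Cauchy criterion at both ends.  It bounds integrals over
    subintervals rather than absolute integrals, so it is compatible with
    conditional convergence and is what the second mean value estimate
    propagates from one integrand to another. *)
Definition small_tails g e d T := [/\ 0 < d, d <= T,
  (forall u v, 0 < u -> u <= v -> v <= d ->
    `|\int[mu]_(t in `[u, v]) g t| <= e) &
  (forall u v, T <= u -> u <= v -> `|\int[mu]_(t in `[u, v]) g t| <= e)].

Lemma improper_integrable_compact g : improper_integrable 0^'+ +oo g ->
  forall x y, 0 < x -> mu.-integrable `[x, y] (EFin \o g).
Proof.
move=> [/near_0yP[d [T [d0 gi]]] _] x y x0.
have [dx Ty] : Num.min x d <= x /\ y <= Num.max y T.
  by rewrite ge_min lexx le_max lexx.
apply: (integrable_itv_sub _ _ (gi (Num.min x d) (Num.max y T) _ _ _)) => //=.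
- by rewrite lt_min x0.
- by rewrite ge_min lexx orbT.
- by rewrite le_max lexx orbT.
Qed.

Lemma improper_integral_approx g e : improper_integrable 0^'+ +oo g -> 0 < e ->
  exists d T, 0 < d /\ forall x y, 0 < x -> x <= d -> T <= y ->
  `|\int[mu]_(t in `[x, y]) g t - improper_integral 0^'+ +oo g| <= e.
Proof.
move=> [_ gc] e0; apply/(near_0yP (fun p => `|compact_integral g p - _| <= e)).
have /cvgrPdist_le/(_ e e0) := gc; apply: filterS => p.
by rewrite distrC.
Qed.

Lemma improper_integrable_small_tails g : improper_integrable 0^'+ +oo g ->
  forall e, 0 < e -> exists d T, small_tails g e d T.
Proof.
move=> gI e e0; have e20 : 0 < e / 2 by rewrite divr_gt0.
have [d [T [d0 dT]]] := improper_integral_approx g _ gI e20.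
have cat := Rintegral_itv_cat g _ _ _ _ _ (improper_integrable_compact g gI _ _ _).
set L := improper_integral _ _ _ in dT.
pose T' := Num.max T d.
exists d, T'; split => //; first by rewrite le_max lexx orbT.
- move=> u v u0 uv vd.
  have vT : v <= T' by rewrite le_max vd orbT.
  have TT' : T <= T' by rewrite le_max lexx.
  have -> : \int[mu]_(t in `[u, v]) g t =
      (\int[mu]_(t in `[u, T']) g t - L) - (\int[mu]_(t in `[v, T']) g t - L).
    by rewrite (cat u v T')//; ring.
  rewrite [leRHS]splitr (le_trans (ler_normB _ _))// lerD// dT//.
    exact: le_trans uv vd.
  exact: lt_le_trans uv.
- move=> u v; rewrite ge_max => /andP[Tu du] uv.
  have -> : \int[mu]_(t in `[u, v]) g t =
      (\int[mu]_(t in `[d, v]) g t - L) - (\int[mu]_(t in `[d, u]) g t - L).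
    by rewrite (cat d u v)//; ring.
  rewrite [leRHS]splitr (le_trans (ler_normB _ _))// lerD// dT//.
  exact: le_trans uv.
Qed.

Lemma small_tails_dist g e d T x y x' y' :
  (forall x y, 0 < x -> mu.-integrable `[x, y] (EFin \o g)) ->
  small_tails g e d T ->
  0 < x -> x <= d -> T <= y -> 0 < x' -> x' <= d -> T <= y' ->
  `|\int[mu]_(t in `[x, y]) g t - \int[mu]_(t in `[x', y']) g t| <= 2 * e.
Proof.
move=> gi [d0 dT g0 gy] x0 xd Ty x'0 x'd Ty'.
have cat := Rintegral_itv_cat g _ _ _ _ _ (gi _ _ _).
have lo a b : 0 < a -> 0 < b -> a <= d -> b <= d ->
    `|\int[mu]_(t in `[a, y]) g t - \int[mu]_(t in `[b, y]) g t| <= e.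
  move=> a0 b0; wlog ab : a b a0 b0 / a <= b => [hw ad bd|ad bd].
    have [ab|/ltW ba] := leP a b; first exact: hw.
    by rewrite distrC; exact: hw.
  rewrite (cat a b y)// ?addrK//; first exact: g0.
  by rewrite (le_trans bd)// (le_trans dT).
have hi a b : T <= a -> T <= b ->
    `|\int[mu]_(t in `[x', a]) g t - \int[mu]_(t in `[x', b]) g t| <= e.
  wlog ab : a b / a <= b => [hw Ta Tb|Ta Tb].
    have [ab|/ltW ba] := leP a b; first exact: hw.
    by rewrite distrC; exact: hw.
  rewrite distrC (cat x' a b)//; last by rewrite (le_trans x'd)// (le_trans dT).
  by rewrite addrC addKr; exact: gy.
rewrite -(subrKA (\int[mu]_(t in `[x', y]) g t)) mulr_natl mulr2n.
by apply: le_trans (ler_normD _ _) _; apply: lerD; [exact: lo|exact: hi].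
Qed.

Lemma small_tails_improper_integrable g :
  (forall x y, 0 < x -> mu.-integrable `[x, y] (EFin \o g)) ->
  (forall e, 0 < e -> exists d T, small_tails g e d T) ->
  improper_integrable 0^'+ +oo g.
Proof.
move=> gi gs; split.
  by apply/near_0yP; exists 1, 0; split=> // x y x0 _ _; exact: gi.
apply/cauchy_cvgP/cauchy_exP => e e0.
have e40 : 0 < e / 4 by rewrite divr_gt0.
have [d [T gdT]] := gs _ e40.
have [d0 dT _ _] := gdT.
exists (\int[mu]_(t in `[d, T]) g t).
apply/(near_0yP (fun p => ball _ e (compact_integral g p))).
exists d, T; split=> // x y x0 xd Ty.
rewrite /ball/= (le_lt_trans (small_tails_dist _ _ _ _ _ _ _ _ gi gdT _ _ _ _ _ _))//.
lra.
Qed.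

(** The thresholds d and T are those of the tails: this is what makes the
    convergence uniform when they serve a whole family of integrands. *)
Lemma small_tails_improper_integral g e d T x y :
  improper_integrable 0^'+ +oo g -> small_tails g e d T ->
  0 < x -> x <= d -> T <= y ->
  `|\int[mu]_(t in `[x, y]) g t - improper_integral 0^'+ +oo g| <= 2 * e.
Proof.
move=> gI gdT x0 xd Ty; apply/ler_addgt0Pr => eta eta0.
have [d' [T' [d'0 H]]] := improper_integral_approx g _ gI eta0.
have x'0 : 0 < Num.min d d' by rewrite lt_min d'0 (lt_le_trans x0).
have := H (Num.min d d') (Num.max T T') x'0.
rewrite ge_min lexx orbT le_max lexx orbT => /(_ isT isT) H'.
rewrite -(subrKA (\int[mu]_(t in `[Num.min d d', Num.max T T']) g t)).
rewrite (le_trans (ler_normD _ _))// lerD//.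
apply: (small_tails_dist _ _ d T) => //.
- exact: improper_integrable_compact.
- by rewrite ge_min lexx.
- by rewrite le_max lexx.
Qed.

Lemma improper_integral_of_approx g L :
  (forall x y, 0 < x -> mu.-integrable `[x, y] (EFin \o g)) ->
  (forall e, 0 < e -> exists d T, 0 < d /\ forall x y, 0 < x -> x <= d -> T <= y ->
    `|\int[mu]_(t in `[x, y]) g t - L| <= e) ->
  improper_integrable 0^'+ +oo g /\ improper_integral 0^'+ +oo g = L.
Proof.
move=> gi gL.
have gc : compact_integral g p @[p --> filter_prod 0^'+ +oo] --> L.
  apply/cvgrPdist_le => e e0.
  apply/(near_0yP (fun p => `|L - compact_integral g p| <= e)).
  have [d [T [d0 H]]] := gL _ e0.
  by exists d, T; split=> // x y x0 xd Ty; rewrite distrC H.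
split; last exact/cvg_lim.
split; last by apply/cvg_ex; exists L.
by apply/near_0yP; exists 1, 0; split=> // x y x0 _ _; exact: gi.
Qed.

End improper_half_line.

(** * Gaussian averages of the Cauchy weight *)

Section stieltjes_kernel.
Context {R : realType}.
Variable a : R.
Hypothesis a_gt0 : 0 < a.
Local Notation mu := (@lebesgue_measure R).
Implicit Types (p q s t u v x y c : R) (B : set (measurableTypeR R)).

Definition cauchy_weight s : R := a / (s ^+ 2 + a ^+ 2).

Lemma cauchy_den_gt0 s : 0 < s ^+ 2 + a ^+ 2.
Proof. by rewrite ltr_wpDl ?sqr_ge0// exprn_gt0. Qed.

Lemma cauchy_weight_gt0 s : 0 < cauchy_weight s.
Proof. by rewrite divr_gt0// cauchy_den_gt0. Qed.

Lemma cauchy_weight_ge0 s : 0 <= cauchy_weight s.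
Proof. exact/ltW/cauchy_weight_gt0. Qed.

Lemma cauchy_weight_le s : cauchy_weight s <= a^-1.
Proof.
rewrite ler_pdivrMr ?cauchy_den_gt0// mulrDr [a ^+ 2]expr2 mulKf ?gt_eqF//.
by rewrite lerDr mulr_ge0 ?invr_ge0 ?sqr_ge0// ltW.
Qed.

Lemma continuous_cauchy_weight : continuous cauchy_weight.
Proof.
move=> s; apply: cvgM; first exact: cvg_cst.
apply: cvgV; first by rewrite gt_eqF ?cauchy_den_gt0.
by apply: cvgD; [exact: exprn_continuous|exact: cvg_cst].
Qed.

Lemma measurable_cauchy_weight : measurable_fun setT cauchy_weight.
Proof.
by apply: continuous_measurable_fun; exact: continuous_cauchy_weight.
Qed.

(** The weight is the derivative of atan (s / a): this gives its total mass, and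
    later the substitution s = a tan theta. *)
Lemma is_derive_atan_scaled s :
  is_derive s 1 (fun s => atan (s / a)) (cauchy_weight s).
Proof.
have -> : cauchy_weight s = (1 + (s / a) ^+ 2)^-1 * a^-1.
  rewrite /cauchy_weight; field; rewrite gt_eqF//= gt_eqF//.
  by have := cauchy_den_gt0 s; lra.
apply: (@is_derive1_comp _ atan (fun s => s / a)).
by apply: is_derive_eq; rewrite ?scaler1 /GRing.scale/= ?mulr1 ?mulr0 ?add0r ?addr0.
Qed.

Lemma integral_cauchy_weight q :
  (\int[mu]_(s in `[q, +oo[) (cauchy_weight s)%:E = (pi / 2 - atan (q / a))%:E)%E.
Proof.
rewrite EFinB; apply: (@ge0_continuous_FTC2y _ _ (fun s => atan (s / a))).
- by move=> s _; exact: cauchy_weight_ge0.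
- exact/continuous_subspaceT/continuous_cauchy_weight.
- apply: (cvg_comp (fun s => s / a) atan); last exact: cvgy_atan.
  under eq_fun do rewrite mulrC.
  have ia0 : 0 < a^-1 by rewrite invr_gt0.
  exact: (gt0_cvgMry ia0 (@cvg_id _ (pinfty_nbhs R))).
- by move=> s _; have [] := is_derive_atan_scaled s.
- apply: cvg_at_right_filter.
  apply: (@continuous_comp _ _ _ (fun s => s / a) atan); last exact: continuous_atan.
  by apply: cvgM; [exact: cvg_id|exact: cvg_cst].
- by move=> s _; rewrite derive1E;
  exact: (@derive_val _ _ _ _ _ _ _ (is_derive_atan_scaled s)).
Qed.

Lemma integrable_cauchy_weight :
  mu.-integrable `[0, +oo[ (EFin \o cauchy_weight).
Proof.
apply/integrableP; split.
  apply/measurable_EFinP; apply: measurable_funTS.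
  exact: measurable_cauchy_weight.
under eq_integral do rewrite /= ger0_norm ?cauchy_weight_ge0//.
by rewrite integral_cauchy_weight ltry.
Qed.

Lemma measurable_gauss_kernel :
  measurable_fun setT (fun z : R * R => expR (- (z.1 ^+ 2 * z.2))).
Proof.
apply: measurableT_comp => //; apply: measurableT_comp => //.
apply: measurable_funM; last exact: measurable_snd.
by apply: measurable_funX; exact: measurable_fst.
Qed.

Lemma gauss_kernel_le1 s t : 0 <= t -> expR (- (s ^+ 2 * t)) <= 1.
Proof. by move=> t0; rewrite -expR0 ler_expR oppr_le0 mulr_ge0// sqr_ge0. Qed.

Lemma integrable_cauchy_gauss B t : measurable B -> B `<=` `[0, +oo[ -> 0 <= t ->
  mu.-integrable B (EFin \o (fun s => cauchy_weight s * expR (- (s ^+ 2 * t)))).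
Proof.
move=> mB B0 t0; apply: (integrable_mul_bounded mu _ _ _ 1) => //.
- exact: (integrableS _ mB B0 integrable_cauchy_weight).
- apply: measurable_funTS.
  exact: (measurableT_comp measurable_gauss_kernel (pair2_measurable t)).
- by move=> s Bs; rewrite ger0_norm ?expR_ge0// gauss_kernel_le1.
Qed.

(** As a function of t this is the Laplace transform of the image under
    s |-> s^2 of the weight restricted to B; varying B separates the small from
    the large frequencies s. *)
Definition cauchy_gauss B t : R :=
  \int[mu]_(s in B) (cauchy_weight s * expR (- (s ^+ 2 * t))).

Local Notation W := (cauchy_gauss `[0, +oo[).
Local Notation lower q := (cauchy_gauss `[0, q]).
Local Notation upper q := (cauchy_gauss `[q, +oo[).

Lemma itv_sub_ge0 q b : 0 <= q -> [set` Interval (BLeft q) b] `<=` `[0, +oo[.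
Proof.
move=> q0 s; rewrite /= !in_itv/= andbT => /andP[qs _]; exact: le_trans qs.
Qed.

Lemma cauchy_gauss_ge0 B t : 0 <= cauchy_gauss B t.
Proof.
by apply: Rintegral_ge0 => s _; rewrite mulr_ge0 ?expR_ge0// cauchy_weight_ge0.
Qed.

Lemma cauchy_gauss_split q t : 0 <= q -> 0 <= t -> W t = lower q t + upper q t.
Proof.
move=> q0 t0; rewrite /cauchy_gauss.
have := @Rintegral_itvB _ _ _ _ q (integrable_cauchy_gauss _ t (measurable_itv _)
  (@subset_refl _ `[0, +oo[%classic) t0).
rewrite bnd_simp => /(_ q0 isT)/eqP; rewrite subr_eq addrC => /eqP ->.
congr (_ + _); apply: Rintegral_itv_obnd_cbnd.
apply: integrable_cauchy_gauss => // s/=.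
by rewrite !in_itv/= !andbT => /ltW; exact: le_trans.
Qed.

Lemma cauchy_gauss_band p q t : 0 <= p -> p <= q -> 0 <= t ->
  cauchy_gauss `[p, q] t = lower q t - lower p t.
Proof.
move=> p0 pq t0; rewrite /cauchy_gauss [in RHS](Rintegral_itv_cat _ 0 p q)//.
  by rewrite addrC addKr.
by apply: integrable_cauchy_gauss => //; exact: itv_sub_ge0.
Qed.

Lemma lower_mass_gt0 q : 0 < q -> 0 < lower q 0.
Proof.
move=> q0.
have Wq s : 0 <= s -> s <= q -> cauchy_weight q <= cauchy_weight s.
  move=> s0 sq; rewrite ler_pM2l// lef_pV2 ?posrE ?cauchy_den_gt0//.
  by rewrite lerD2r ler_sqr ?nnegrE// ltW.
apply: (@lt_le_trans _ _ (cauchy_weight q * (q - 0))).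
  by rewrite mulr_gt0 ?cauchy_weight_gt0// subr0.
rewrite /cauchy_gauss -(Rintegral_itv_cst _ _ _ (ltW q0)); apply: le_Rintegral => //.
- exact: integrable_itv_cst.
- by apply: integrable_cauchy_gauss => //; exact: itv_sub_ge0.
- by move=> s; rewrite /= in_itv/= => /andP[s0 sq]; rewrite mulr0 oppr0 expR0 mulr1 Wq.
Qed.

Lemma lower_mass_le q : 0 <= q -> lower q 0 <= q / a.
Proof.
move=> q0; have -> : q / a = a^-1 * (q - 0) by rewrite subr0 mulrC.
rewrite /cauchy_gauss -Rintegral_itv_cst//; apply: le_Rintegral => //.
- by apply: integrable_cauchy_gauss => //; exact: itv_sub_ge0.
- exact: integrable_itv_cst.
- by move=> s _; rewrite mulr0 oppr0 expR0 mulr1 cauchy_weight_le.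
Qed.

Lemma upper_mass q : upper q 0 = pi / 2 - atan (q / a).
Proof.
rewrite /cauchy_gauss /Rintegral.
under eq_integral do rewrite mulr0 oppr0 expR0 mulr1.
by rewrite integral_cauchy_weight.
Qed.

Lemma cauchy_gauss_decr B t u : measurable B -> B `<=` `[0, +oo[ ->
  0 <= t -> t <= u -> cauchy_gauss B u <= cauchy_gauss B t.
Proof.
move=> mB B0 t0 tu; rewrite /cauchy_gauss; apply: le_Rintegral => //.
- by apply: integrable_cauchy_gauss => //; exact: le_trans tu.
- exact: integrable_cauchy_gauss.
move=> s _; rewrite ler_wpM2l ?cauchy_weight_ge0// ler_expR lerN2.
by rewrite ler_wpM2l// sqr_ge0.
Qed.

(** Between the times t and u each frequency s loses the factor
    exp (- s^2 (u - t)), which is at least exp (- q^2 (u - t)) for s <= q. *)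
Lemma lower_growth q t u : 0 <= q -> 0 <= t -> t <= u ->
  expR (- (q ^+ 2 * (u - t))) * lower q t <= lower q u.
Proof.
move=> q0 t0 tu; have i v : 0 <= v -> mu.-integrable `[0, q] (EFin \o
    (fun s => cauchy_weight s * expR (- (s ^+ 2 * v)))).
  by move=> v0; apply: integrable_cauchy_gauss => //; exact: itv_sub_ge0.
rewrite /cauchy_gauss -RintegralZl//; last exact: i.
apply: le_Rintegral => //.
- apply: (integrableZl _ _ (i t t0)) => //.
- by apply: i; exact: le_trans tu.
move=> s; rewrite /= in_itv/= => /andP[s0 sq].
rewrite mulrCA ler_wpM2l ?cauchy_weight_ge0// -expRD ler_expR.
have : s ^+ 2 * (u - t) <= q ^+ 2 * (u - t).
  by rewrite ler_wpM2r ?subr_ge0// ler_sqr ?nnegrE.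
lra.
Qed.

(** The frequencies above q lose at least the factor that those below q lose at
    most. *)
Lemma upper_decay q t u : 0 <= q -> 0 <= t -> t <= u ->
  upper q u <= expR (- (q ^+ 2 * (u - t))) * upper q t.
Proof.
move=> q0 t0 tu; have i v : 0 <= v -> mu.-integrable `[q, +oo[ (EFin \o
    (fun s => cauchy_weight s * expR (- (s ^+ 2 * v)))).
  by move=> v0; apply: integrable_cauchy_gauss => //; exact: itv_sub_ge0.
rewrite /cauchy_gauss -RintegralZl//; last exact: i.
apply: le_Rintegral => //.
- by apply: i; exact: le_trans tu.
- apply: (integrableZl _ _ (i t t0)) => //.
move=> s; rewrite /= in_itv/= andbT => qs.
rewrite [leRHS]mulrCA ler_wpM2l ?cauchy_weight_ge0// -expRD ler_expR.
have : q ^+ 2 * (u - t) <= s ^+ 2 * (u - t).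
  by rewrite ler_wpM2r ?subr_ge0// ler_sqr ?nnegrE// (le_trans q0).
lra.
Qed.

Lemma cauchy_gauss_lower_bound q t : 0 <= q -> 0 <= t ->
  expR (- (q ^+ 2 * t)) * lower q 0 <= W t.
Proof.
move=> q0 t0; have := lower_growth q 0 t q0 (lexx _) t0.
rewrite subr0 => /le_trans; apply.
by rewrite (cauchy_gauss_split q)// lerDl cauchy_gauss_ge0.
Qed.

Lemma cauchy_gauss_gt0 t : 0 <= t -> 0 < W t.
Proof.
move=> t0; rewrite (lt_le_trans _ (cauchy_gauss_lower_bound 1 t _ _))//.
by rewrite mulr_gt0 ?expR_gt0// lower_mass_gt0.
Qed.

(** As time passes, the frequencies below q decay more slowly than those above,
    so that their share of the total increases. *)
Lemma lower_ratio_nondecreasing q t u : 0 <= q -> 0 <= t -> t <= u ->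
  lower q t / W t <= lower q u / W u.
Proof.
move=> q0 t0 tu; have u0 := le_trans t0 tu.
have := cauchy_gauss_gt0 t t0; have := cauchy_gauss_gt0 u u0.
rewrite (cauchy_gauss_split q t)// (cauchy_gauss_split q u)//.
have := lower_growth q t u q0 t0 tu; have := upper_decay q t u q0 t0 tu.
have := cauchy_gauss_ge0 `[0, q] t; have := cauchy_gauss_ge0 `[q, +oo[ t.
move: (lower q t) (lower q u) (upper q t) (upper q u) (expR _) => lt lu ut uu e.
move=> ut0 lt0 uue elu Wu Wt.
rewrite ler_pdivrMr// mulrAC ler_pdivlMr// !mulrDr [lu * lt]mulrC lerD2l.
apply: (le_trans (ler_wpM2l lt0 uue)).
by rewrite mulrA [lt * e]mulrC ler_wpM2r.
Qed.

Lemma lower_ratio01 q t : 0 <= q -> 0 <= t -> 0 <= lower q t / W t <= 1.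
Proof.
move=> q0 t0; rewrite divr_ge0 ?cauchy_gauss_ge0//=.
rewrite ler_pdivrMr ?cauchy_gauss_gt0// mul1r (cauchy_gauss_split q)//.
by rewrite lerDl cauchy_gauss_ge0.
Qed.

(** Up to the factor y - x, this is the convexity of t |-> exp (c t) W t, inherited
    from the exponentials exp ((c - s^2) t) of which it is a superposition. *)
Lemma expR_cauchy_gauss_convex c x t y : 0 <= x -> x <= t -> t <= y ->
  (y - x) * (expR (c * t) * W t) <=
  (y - t) * (expR (c * x) * W x) + (t - x) * (expR (c * y) * W y).
Proof.
move=> x0 xt ty; have t0 := le_trans x0 xt; have y0 := le_trans t0 ty.
have i k v : 0 <= v -> mu.-integrable `[0, +oo[ (EFin \o
    (fun s => k * (cauchy_weight s * expR (- (s ^+ 2 * v))))).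
  move=> v0; apply: (integrableZl _ k (integrable_cauchy_gauss _ v _ _ v0)) => //.
have E k v : 0 <= v -> k * W v =
    \int[mu]_(s in `[0, +oo[) (k * (cauchy_weight s * expR (- (s ^+ 2 * v)))).
  by move=> v0; rewrite RintegralZl//; exact: integrable_cauchy_gauss.
rewrite !mulrA !E// -RintegralD//; [|exact: i|exact: i].
apply: le_Rintegral => //; first exact: i.
  by apply: (integrableD _ (i _ x x0) (i _ y y0)).
move=> s _; set w := cauchy_weight s.
have w0 : 0 <= w := cauchy_weight_ge0 s.
set r := c - s ^+ 2.
have ex v : expR (c * v) * expR (- (s ^+ 2 * v)) = expR (r * v).
  by rewrite -expRD /r; congr expR; ring.
have L : (y - x) * expR (r * t) <= (y - t) * expR (r * x) + (t - x) * expR (r * y).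
  (* The graph of exp (r v) lies above its tangent at v = t. *)
  have tangent v : expR (r * t) * (1 + r * (v - t)) <= expR (r * v).
    have -> : expR (r * v) = expR (r * t) * expR (r * (v - t)).
      by rewrite -expRD; congr expR; ring.
    by rewrite ler_pM2l ?expR_gt0// expR_ge1Dx.
  have yt0 : 0 <= y - t by rewrite subr_ge0.
  have tx0 : 0 <= t - x by rewrite subr_ge0.
  have := lerD (ler_wpM2l yt0 (tangent x)) (ler_wpM2l tx0 (tangent y)).
  by apply: le_trans; rewrite le_eqVlt; apply/orP; left; apply/eqP; ring.
have -> : (y - x) * expR (c * t) * (w * expR (- (s ^+ 2 * t))) =
  w * ((y - x) * expR (r * t)) by rewrite -ex; ring.
have -> : (y - t) * expR (c * x) * (w * expR (- (s ^+ 2 * x))) +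
  (t - x) * expR (c * y) * (w * expR (- (s ^+ 2 * y))) =
  w * ((y - t) * expR (r * x) + (t - x) * expR (r * y)) by rewrite -!ex; ring.
exact: ler_wpM2l.
Qed.

(** The inverse of a positive convex function is quasi-concave. *)
Lemma laplace_kernel_quasi_concave c x y : 0 <= x ->
  quasi_concave x y (fun t => expR (- (c * t)) / W t).
Proof.
move=> x0 u t v xu ut tv vy.
have u0 := le_trans x0 xu; have t0 := le_trans u0 ut; have v0 := le_trans t0 tv.
pose D z := expR (c * z) * W z.
have D0 z : 0 <= z -> 0 < D z.
  by move=> z0; rewrite mulr_gt0 ?expR_gt0 ?cauchy_gauss_gt0.
have kD z : expR (- (c * z)) / W z = (D z)^-1 by rewrite /D invfM expRN.
have [->|tu'] := eqVneq t u; first by rewrite ge_min lexx.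
rewrite !kD; have := expR_cauchy_gauss_convex c u t v u0 ut tv.
rewrite -/(D u) -/(D v) -/(D t).
move: (D0 u u0) (D0 v v0) (D0 t t0).
move: (D u) (D v) (D t) => Du Dv Dt Du0 Dv0 Dt0 cvx {D D0 kD}.
rewrite ge_min !lef_pV2 ?posrE//.
have [//|Dut] := leP Dt Du; have [//|Dvt] := leP Dt Dv.
exfalso; move: cvx; apply/negP; rewrite -ltNge.
have -> : (v - u) * Dt = (v - t) * Dt + (t - u) * Dt by ring.
have ut' : u < t by rewrite lt_neqAle eq_sym tu'.
by rewrite ler_ltD// ?ltr_pM2l ?subr_gt0// ler_wpM2l ?subr_ge0// ltW.
Qed.

(** The bound does not depend on c >= q^2: the frequencies below q alone keep
    W t above a multiple of exp (- q^2 t). *)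
Lemma laplace_kernel_bound c q t : 0 < q -> q ^+ 2 <= c -> 0 <= t ->
  0 <= expR (- (c * t)) / W t <= (lower q 0)^-1.
Proof.
move=> q0 qc t0; rewrite divr_ge0 ?expR_ge0 ?cauchy_gauss_ge0//=.
rewrite ler_pdivrMr ?cauchy_gauss_gt0// ler_pdivlMl ?lower_mass_gt0//.
rewrite mulrC (le_trans _ (cauchy_gauss_lower_bound q t (ltW q0) t0))//.
by rewrite ler_wpM2r ?cauchy_gauss_ge0// ler_expR lerN2 ler_wpM2r.
Qed.

End stieltjes_kernel.

(** * The complementary error function as a Gaussian average *)

Section erfc_representation.
Context {R : realType}.
Local Notation mu := (@lebesgue_measure R).
Implicit Types (a c k s t v A : R).

Lemma erfc_tail A : 0 <= A ->
  erfc A = 2 / Num.sqrt pi * \int[mu]_(v in `[A, +oo[) expR (- v ^+ 2).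
Proof.
move=> A0; rewrite /erfc /erf A0.
have gi (B : set (measurableTypeR R)) : measurable B ->
    mu.-integrable B (EFin \o gauss_fun).
  by move=> mB; exact: (integrableS _ mB _ integrableT_gauss).
have sp : 0 < Num.sqrt pi :> R by rewrite sqrtr_gt0 pi_gt0.
have half : \int[mu]_(v in `[0, +oo[) expR (- v ^+ 2) = Num.sqrt pi / 2.
  by have := @integral0y_gauss R; rewrite /Rintegral /gauss_fun => ->.
have := @Rintegral_itvB R gauss_fun (BLeft 0) +oo%O A (gi _ (measurable_itv _)).
rewrite !bnd_simp => /(_ A0 isT); rewrite /gauss_fun half => E.
rewrite -Rintegral_itv_obnd_cbnd; last exact: gi.
rewrite -E; field; exact: lt0r_neq0.
Qed.

Lemma integral_gauss_scaled k : 0 < k ->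
  (\int[mu]_(s in `[0%R, +oo[) (expR (- (s * k) ^+ 2))%:E =
   (Num.sqrt pi / (2 * k))%:E)%E.
Proof.
move=> k0.
have dF : derive1 ( *%R^~ k) = cst k.
  by apply/funext => s; rewrite derive1Mr// derive1_id mul1r.
have := @increasing_ge0_integration_by_substitutiony R ( *%R^~ k) gauss_fun 0.
rewrite mul0r dF integral0y_gauss => H.
have {}H : ((Num.sqrt pi / 2)%:E =
    \int[mu]_(s in `[0%R, +oo[) (k%:E * (expR (- (s * k) ^+ 2))%:E))%E.
  rewrite H.
  - by apply: eq_integral => s _; rewrite -EFinM mulrC.
  - by move=> x y _ _ xy; rewrite ltr_pM2r.
  - by move=> x _; exact: cvg_cst.
  - exact: is_cvg_cst.
  - exact: is_cvg_cst.
  - split; first by [].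
    by apply: cvg_at_right_filter; apply: cvgM; [exact: cvg_id|exact: cvg_cst].
  - under eq_fun do rewrite mulrC.
    exact: (gt0_cvgMry k0 (@cvg_id _ (pinfty_nbhs R))).
  - by apply: continuous_subspaceT; exact: continuous_gauss_fun.
  - by move=> x _; exact: gauss_fun_ge0.
move: H; rewrite ge0_integralZl//; last 2 first.
- apply/measurable_EFinP; apply: measurable_funTS; apply: measurableT_comp => //.
  apply: measurableT_comp => //; apply: measurable_funX.
  exact: measurable_funM.
- by rewrite lee_fin ltW.
move=> H.
have -> : (Num.sqrt pi / (2 * k))%:E = ((k^-1)%:E * (Num.sqrt pi / 2)%:E)%E.
  by rewrite -EFinM; congr EFin; field; exact: lt0r_neq0.
by rewrite H muleA -EFinM mulVf ?mul1e// gt_eqF.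
Qed.

Lemma integral_linear_gauss_tail c A : 0 < c -> 0 <= A ->
  (\int[mu]_(v in `[A, +oo[) (v * expR (- (c * v ^+ 2)))%:E =
   (expR (- (c * A ^+ 2)) / (2 * c))%:E)%E.
Proof.
move=> c0 A0.
pose F v := - (expR (- (c * v ^+ 2)) / (2 * c)).
have dF v : is_derive v 1 F (v * expR (- (c * v ^+ 2))).
  pose G v := - (c * v ^+ 2).
  have dG : is_derive v 1 G (- (c * (2 * v))).
    rewrite /G; apply: is_derive_eq; rewrite /GRing.scale/=; ring.
  have dE : is_derive v 1 (expR \o G) (expR (G v) * - (c * (2 * v))).
    exact: is_derive1_comp.
  rewrite (_ : F = fun v => (- (2 * c)^-1) * (expR \o G) v); last first.
    by apply/funext => w; rewrite /F /= mulNr mulrC.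
  apply: is_derive_eq; rewrite /GRing.scale/= /G; field; exact: lt0r_neq0.
have cF v : continuous_at v F.
  by apply/differentiable_continuous/derivable1_diffP; have [] := dF v.
have -> : (expR (- (c * A ^+ 2)) / (2 * c))%:E = (0%:E - (F A)%:E)%E.
  by rewrite /F -EFinB sub0r opprK.
apply: ge0_continuous_FTC2y.
- by move=> v Av; rewrite mulr_ge0 ?expR_ge0// (le_trans A0).
- apply: continuous_subspaceT => v; apply: cvgM; first exact: cvg_id.
  apply: (@continuous_comp _ _ _ (fun v => - (c * v ^+ 2)) expR);
    last exact: continuous_expR.
  by apply: cvgN; apply: cvgM; [exact: cvg_cst|exact: exprn_continuous].
- rewrite -oppr0 -(mul0r (2 * c)^-1); apply: cvgN; apply: cvgM; last exact: cvg_cst.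
  apply: (cvg_comp (fun v => c * v ^+ 2) (fun x => expR (- x))); last exact: cvgr_expR.
  exact: (gt0_cvgMry c0 (@cvgr_expr2 R)).
- by move=> v _; have [] := dF v.
- by apply: cvg_at_right_filter; exact: cF.
- by move=> v _; rewrite derive1E; exact: (@derive_val _ _ _ _ _ _ _ (dF v)).
Qed.

Lemma integrable_linear_gauss_tail c A : 0 < c -> 0 <= A ->
  mu.-integrable `[A, +oo[ (EFin \o (fun v => v * expR (- (c * v ^+ 2)))).
Proof.
move=> c0 A0; apply: (integrable_ge0_fin mu _ _ _ _ _ _
  (integral_linear_gauss_tail c A c0 A0)) => //.
- apply: measurable_funTS; apply: measurable_funM => //.
  apply: measurableT_comp => //; apply: measurableT_comp => //.
  by apply: measurable_funM => //; exact: measurable_funX.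
- move=> v; rewrite /= in_itv/= andbT => Av.
  by rewrite mulr_ge0 ?expR_ge0// (le_trans A0).
Qed.

(** Integrate (v / a) * exp (- v^2 (1 + (s / a)^2)) over v >= A = a sqrt t and
    s >= 0.  Integrating in s first gives a Gauss integral and leaves the tail of
    the Gaussian, hence erfc A; integrating in v first is elementary and leaves
    exp (- a^2 t) / 2 times the integrand of W t. *)
Lemma cauchy_gauss_erfc a t : 0 < a -> 0 < t ->
  cauchy_gauss a `[0, +oo[ t = pi / 2 * (expR (a ^+ 2 * t) * erfc (a * Num.sqrt t)).
Proof.
move=> a0 t0; set A := a * Num.sqrt t.
have st0 : 0 < Num.sqrt t by rewrite sqrtr_gt0.
have A0 : 0 < A by rewrite mulr_gt0.
have A2 : A ^+ 2 = a ^+ 2 * t by rewrite exprMn sqr_sqrtr// ltW.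
have an0 : a != 0 by rewrite gt_eqF.
(* The integrand is split as f v * g s * K (v, s).  The factor
   exp (- A^2 (s / a)^2) is put in g, which makes g integrable and keeps K
   below 1 because v >= A. *)
pose f v := v / a * expR (- v ^+ 2).
pose g s := expR (- (s * Num.sqrt t) ^+ 2).
pose K (z : R * R) := expR (- ((z.1 ^+ 2 - A ^+ 2) * (z.2 / a) ^+ 2)).
have gE s : g s = expR (- (A ^+ 2 * (s / a) ^+ 2)).
  by rewrite /g A2 exprMn sqr_sqrtr ?ltW//; congr expR; field.
have mX : measurable_fun setT (fun v : R => expR (- v ^+ 2)).
  exact: measurable_gauss_fun.
have fi : mu.-integrable `[A, +oo[ (EFin \o f).
  have mi : measurable (`[A, +oo[%classic : set (measurableTypeR R)) by [].
  have := integrableZl mi a^-1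
    (integrable_linear_gauss_tail 1 A ltr01 (ltW A0)).
  rewrite (_ : (fun _ => _) = EFin \o f)//; apply/funext => v /=.
  by rewrite /f mul1r -EFinM mulrA [a^-1 * _]mulrC.
have gi : mu.-integrable `[0, +oo[ (EFin \o g).
  apply: (@integrable_ge0_fin _ _ _ mu _ _ (Num.sqrt pi / (2 * Num.sqrt t))) => //.
  - apply: measurable_funTS; apply: (measurableT_comp mX).
    exact: measurable_funM.
  - by move=> *; exact: expR_ge0.
  exact: integral_gauss_scaled.
have mK : measurable_fun setT K.
  apply: measurableT_comp => //; apply: measurableT_comp => //.
  apply: measurable_funM.
    by apply: measurable_funB => //; apply: measurable_funX; exact: measurable_fst.
  by apply: measurable_funX; apply: measurable_funM => //; exact: measurable_snd.
have K1 v s : `[A, +oo[%classic v -> `[0, +oo[%classic s -> `|K (v, s)| <= 1.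
  rewrite /= !in_itv/= !andbT => Av s0; rewrite ger0_norm ?expR_ge0//.
  rewrite -expR0 ler_expR oppr_le0 mulr_ge0 ?sqr_ge0// subr_ge0.
  by rewrite ler_sqr// nnegrE ?(ltW A0)// (le_trans (ltW A0)).
have := Rintegral_bounded_kernel_swap mu mu _ _ _ _ _ _ (measurable_itv _)
  (measurable_itv _) fi gi mK K1.
have -> : \int[mu]_(v in `[A, +oo[) (f v * \int[mu]_(s in `[0, +oo[) (g s * K (v, s))) =
   Num.sqrt pi / 2 * \int[mu]_(v in `[A, +oo[) expR (- v ^+ 2).
  rewrite -RintegralZl//; last first.
    exact: (integrableS _ _ _ integrableT_gauss).
  apply: eq_Rintegral => v; rewrite inE/= in_itv/= andbT => Av.
  have v0 : 0 < v := lt_le_trans A0 Av.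
  have -> : \int[mu]_(s in `[0, +oo[) (g s * K (v, s)) = Num.sqrt pi / (2 * (v / a)).
    rewrite /Rintegral -[RHS]/(fine (_)%:E) -integral_gauss_scaled ?divr_gt0//.
    congr fine; apply: eq_integral => s _.
    by rewrite gE /K/= -expRD; congr (expR _)%:E; field.
  by rewrite /f; field; rewrite an0 gt_eqF.
have -> : \int[mu]_(s in `[0, +oo[) (g s * \int[mu]_(v in `[A, +oo[) (f v * K (v, s))) =
   expR (- (a ^+ 2 * t)) / 2 * cauchy_gauss a `[0, +oo[ t.
  rewrite /cauchy_gauss -RintegralZl//; last first.
    by apply: integrable_cauchy_gauss => //; exact: ltW.
  apply: eq_Rintegral => s _.
  pose c := 1 + (s / a) ^+ 2.
  have c0 : 0 < c by rewrite ltr_wpDr ?sqr_ge0.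
  have -> : \int[mu]_(v in `[A, +oo[) (f v * K (v, s)) =
      expR (A ^+ 2 * (s / a) ^+ 2) / a * (expR (- (c * A ^+ 2)) / (2 * c)).
    have tail := integral_linear_gauss_tail c A c0 (ltW A0).
    have <- : \int[mu]_(v in `[A, +oo[) (v * expR (- (c * v ^+ 2))) =
      expR (- (c * A ^+ 2)) / (2 * c) by rewrite /Rintegral tail.
    rewrite -RintegralZl//; last first.
      exact: integrable_linear_gauss_tail (ltW A0).
    apply: eq_Rintegral => v _; rewrite /f /K/=.
    have -> : expR (- ((v ^+ 2 - A ^+ 2) * (s / a) ^+ 2)) =
      expR (A ^+ 2 * (s / a) ^+ 2) * expR (v ^+ 2) * expR (- (c * v ^+ 2)).
      by rewrite -!expRD; congr expR; rewrite /c; ring.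
    rewrite -[X in _ = _ * X]mul1r -(expRxMexpNx_1 (v ^+ 2)).
    by field.
  have -> : expR (- (c * A ^+ 2)) = expR (- (a ^+ 2 * t)) * g s.
    by rewrite gE -expRD A2; congr expR; rewrite /c; ring.
  have -> : expR (- (s ^+ 2 * t)) = g s.
    by rewrite /g exprMn sqr_sqrtr// ltW.
  have Ng : expR (A ^+ 2 * (s / a) ^+ 2) * g s = 1 by rewrite gE expRxMexpNx_1.
  rewrite /cauchy_weight.
  transitivity ((expR (A ^+ 2 * (s / a) ^+ 2) * g s) *
    (g s * expR (- (a ^+ 2 * t)) / a / (2 * c))).
    by ring.
  rewrite Ng /c; field; rewrite an0/=.
  by have := cauchy_den_gt0 a a0 s; rewrite addrC => h; rewrite gt_eqF.
have sp : 0 < Num.sqrt pi :> R by rewrite sqrtr_gt0 pi_gt0.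
set T := \int[mu]_(v in _) _ => H.
have -> : cauchy_gauss a `[0, +oo[ t = Num.sqrt pi * expR (a ^+ 2 * t) * T.
  have := congr1 (fun z => 2 * expR (a ^+ 2 * t) * z) H.
  have -> : 2 * expR (a ^+ 2 * t) * (expR (- (a ^+ 2 * t)) / 2 *
    cauchy_gauss a `[0, +oo[ t) = expR (a ^+ 2 * t) * expR (- (a ^+ 2 * t)) *
    cauchy_gauss a `[0, +oo[ t by field.
  by rewrite expRxMexpNx_1 mul1r => <-; field.
rewrite (erfc_tail _ (ltW A0)) -/T.
have q2 : pi = Num.sqrt pi * Num.sqrt pi :> R by rewrite -expr2 sqr_sqrtr// pi_ge0.
set q := Num.sqrt pi in sp q2 *; rewrite q2.
by field; exact: lt0r_neq0.
Qed.
End erfc_representation.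

(** * Convergence and continuity of the Laplace transform *)

Section laplace_stieltjes.
Context {R : realType}.
Variables (a : R) (f : R -> R).
Hypothesis a_gt0 : 0 < a.
Local Notation mu := (@lebesgue_measure R).
Local Notation w := (cauchy_weight a).
Local Notation W := (cauchy_gauss a `[0, +oo[).
Local Notation lower q := (cauchy_gauss a `[0, q]).
Local Notation upper q := (cauchy_gauss a `[q, +oo[).
Local Notation h := (fun t => f t * W t).
Hypothesis hI : improper_integrable 0^'+ +oo h.
Implicit Types (p q s t u v x y c d e T M : R) (g G : R -> R).

Let h_compact := improper_integrable_compact _ hI.

Lemma integrable_quasi_concave_mul g M u v : 0 < u -> quasi_concave u v g ->
  (forall t, u <= t -> t <= v -> 0 <= g t <= M) ->
  mu.-integrable `[u, v] (EFin \o (fun t => h t * g t)).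
Proof.
move=> u0 qg gM; apply: (integrable_mul_bounded mu _ _ _ M) => //.
- exact: h_compact.
- exact: quasi_concave_measurable.
- move=> t; rewrite /= in_itv/= => /andP[ut tv].
  by have /andP[g0 gt] := gM t ut tv; rewrite ger0_norm.
Qed.

Lemma mul_kernel G u v t : 0 < u -> t \in `[u, v]%classic ->
  f t * G t = h t * (G t / W t).
Proof.
move=> u0; rewrite inE/= in_itv/= => /andP[ut _].
have W0 : W t != 0.
  by rewrite gt_eqF// cauchy_gauss_gt0// (le_trans (ltW u0)).
by rewrite -mulrA [W t * _]mulrC divfK.
Qed.

Lemma integrable_mul_kernel G M u v : 0 < u ->
  quasi_concave u v (fun t => G t / W t) ->
  (forall t, u <= t -> t <= v -> 0 <= G t / W t <= M) ->
  mu.-integrable `[u, v] (EFin \o (fun t => f t * G t)).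
Proof.
move=> u0 qg gM.
apply: eq_integrable (integrable_quasi_concave_mul _ M _ _ u0 qg gM) => //.
by move=> t tuv /=; rewrite -(mul_kernel G u v).
Qed.

(** Although only the integrals of h = f W are known to converge, f G is
    controlled as soon as G / W is quasi-concave and bounded. *)
Lemma normr_Rintegral_mul_kernel G M e u v : 0 < u -> 0 <= M -> 0 <= e ->
  quasi_concave u v (fun t => G t / W t) ->
  (forall t, u <= t -> t <= v -> 0 <= G t / W t <= M) ->
  (forall x y, u <= x -> x <= y -> y <= v ->
    `|\int[mu]_(t in `[x, y]) h t| <= e) ->
  `|\int[mu]_(t in `[u, v]) (f t * G t)| <= M * e.
Proof.
move=> u0 M0 e0 qg gM he.
have -> : \int[mu]_(t in `[u, v]) (f t * G t) =
    \int[mu]_(t in `[u, v]) (h t * (G t / W t)).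
  by apply: eq_Rintegral => t tuv; rewrite (mul_kernel G u v).
by apply: quasi_concave_second_mean_value => //; exact: h_compact.
Qed.

Lemma integrable_laplace_kernel c x y : 0 < x -> 0 <= c ->
  mu.-integrable `[x, y] (EFin \o (fun t => f t * expR (- (c * t)))).
Proof.
move=> x0 c0; apply: (integrable_mul_kernel _ (W y)^-1) => //.
  exact/laplace_kernel_quasi_concave/ltW.
move=> t xt ty; have t0 := le_trans (ltW x0) xt; have y0 := le_trans t0 ty.
rewrite divr_ge0 ?expR_ge0 ?cauchy_gauss_ge0//=.
rewrite -[leRHS]mul1r ler_pM ?expR_ge0 ?invr_ge0 ?cauchy_gauss_ge0//.
  by rewrite -expR0 ler_expR oppr_le0 mulr_ge0.
rewrite lef_pV2 ?posrE ?cauchy_gauss_gt0//.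
exact: cauchy_gauss_decr.
Qed.

(** The same thresholds d and T serve all the c >= q^2. *)
Lemma laplace_small_tails q c e d T : 0 < q -> q ^+ 2 <= c -> 0 <= e ->
  small_tails h e d T ->
  small_tails (fun t => f t * expR (- (c * t))) ((lower q 0)^-1 * e) d T.
Proof.
move=> q0 qc e0 [d0 dT h0 hy].
have M0 : 0 <= (lower q 0)^-1 by rewrite invr_ge0 cauchy_gauss_ge0.
have key u v : 0 < u -> (forall x y, u <= x -> x <= y -> y <= v ->
    `|\int[mu]_(t in `[x, y]) h t| <= e) ->
    `|\int[mu]_(t in `[u, v]) (f t * expR (- (c * t)))| <= (lower q 0)^-1 * e.
  move=> u0; apply: normr_Rintegral_mul_kernel => //.
    exact/laplace_kernel_quasi_concave/ltW.
  by move=> t ut tv; rewrite laplace_kernel_bound// (le_trans (ltW u0)).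
split=> // [u v u0 uv vd|u v Tu uv].
  apply: key => // x y ux xy yv.
  by apply: h0 => //; [exact: lt_le_trans ux|exact: le_trans vd].
apply: key => [|x y ux xy yv]; first exact: lt_le_trans (le_trans dT Tu).
by apply: hy => //; exact: le_trans ux.
Qed.

Lemma laplace_integrable c : 0 < c ->
  improper_integrable 0^'+ +oo (fun t => f t * expR (- (c * t))).
Proof.
move=> c0; apply: small_tails_improper_integrable => [x y x0|e e0].
  exact/integrable_laplace_kernel/ltW.
have q0 : 0 < Num.sqrt c by rewrite sqrtr_gt0.
have M0 : 0 < lower (Num.sqrt c) 0 by rewrite lower_mass_gt0.
have e'0 : 0 < lower (Num.sqrt c) 0 * e by rewrite mulr_gt0.
have [d [T hdT]] := improper_integrable_small_tails _ hI _ e'0.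
exists d, T; have := laplace_small_tails _ c _ d T q0 _ (ltW e'0) hdT.
by rewrite mulKf ?gt_eqF//; apply; rewrite sqr_sqrtr// ltW.
Qed.

Lemma laplace_approx q c e d T x y : 0 < q -> q ^+ 2 <= c -> 0 <= e ->
  small_tails h e d T -> 0 < x -> x <= d -> T <= y ->
  `|\int[mu]_(t in `[x, y]) (f t * expR (- (c * t))) - laplace f c| <=
  2 * ((lower q 0)^-1 * e).
Proof.
move=> q0 qc e0 hdT x0 xd Ty.
have c0 : 0 < c by rewrite (lt_le_trans _ qc)// exprn_gt0.
have tl := laplace_small_tails q c e d T q0 qc e0 hdT.
exact: (small_tails_improper_integral _ _ _ _ _ _ (laplace_integrable c c0) tl).
Qed.

Lemma integrable_f x y : 0 < x -> mu.-integrable `[x, y] (EFin \o f).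
Proof.
move=> x0; apply: eq_integrable (integrable_laplace_kernel 0 x y x0 (lexx 0)) => //.
by move=> t _ /=; rewrite mul0r oppr0 expR0 mulr1.
Qed.

Lemma truncated_laplace_continuous x y c : 0 < x -> 0 < c ->
  {for c, continuous (fun c => \int[mu]_(t in `[x, y]) (f t * expR (- (c * t))))}.
Proof.
move=> x0 c0.
apply: (@continuity_under_integral R _ _ mu
  (fun c t => f t * expR (- (c * t))) `[x, y] _ 0 (c + 1) _ _ (fun t => `|f t|)).
- by [].
- move=> s; rewrite /= in_itv/= => /andP[s0 _].
  exact/integrable_laplace_kernel/ltW.
- apply: aeW => t _ s _; apply: cvgM; first exact: cvg_cst.
  apply: (@continuous_comp _ _ _ (fun s => - (s * t)) expR);
    last exact: continuous_expR.
  by apply: cvgN; apply: cvgM; [exact: cvg_id|exact: cvg_cst].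
- exact/integrable_norm/integrable_f.
- move=> s; rewrite /= in_itv/= => /andP[s0 _].
  apply: aeW => t; rewrite /= in_itv/= => /andP[xt _].
  rewrite normrM ler_piMr// ger0_norm ?expR_ge0//.
  by rewrite -expR0 ler_expR oppr_le0 mulr_ge0 ?ltW// (lt_le_trans x0).
- by rewrite inE/= in_itv/= c0 ltrDl ltr01.
Qed.

Lemma laplace_continuous c : 0 < c -> {for c, continuous (laplace f)}.
Proof.
move=> c0; apply/cvgrPdist_le => e e0.
(* With q^2 = c / 2 the convergence is uniform on [c / 2, +oo[, which contains a
   neighbourhood of c. *)
pose q := Num.sqrt (c / 2).
have c20 : 0 < c / 2 by rewrite divr_gt0.
have q0 : 0 < q by rewrite sqrtr_gt0.
have q2 : q ^+ 2 = c / 2 by rewrite sqr_sqrtr// ltW.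
have M0 : 0 < lower q 0 by rewrite lower_mass_gt0.
have e'0 : 0 < lower q 0 * (e / 6) by rewrite mulr_gt0// divr_gt0.
have [d [T hdT]] := improper_integrable_small_tails _ hI _ e'0.
have [d0 dT _ _] := hdT.
have ap s : c / 2 <= s ->
    `|\int[mu]_(t in `[d, T]) (f t * expR (- (s * t))) - laplace f s| <= 2 * (e / 6).
  move=> cs; have := laplace_approx q s _ d T d T q0 _ (ltW e'0) hdT d0 (lexx _) (lexx _).
  by rewrite mulKf ?gt_eqF//; apply; rewrite q2.
have tri (Fc Ic Is Fs : R) : `|Ic - Is| <= e / 3 ->
    `|Is - Fs| <= 2 * (e / 6) -> `|Ic - Fc| <= 2 * (e / 6) -> `|Fc - Fs| <= e.
  rewrite !ler_norml => /andP[? ?] /andP[? ?] /andP[? ?].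
  by apply/andP; split; lra.
have e30 : 0 < e / 3 by rewrite divr_gt0.
have /cvgrPdist_le/(_ _ e30) := truncated_laplace_continuous d T c d0 c0.
apply: filter_app; near=> s => Is.
have cs : c / 2 <= s 
  by near: s; apply: (cvgr_ge c) => //; rewrite ltr_pdivrMr// ltr_pMr// ltr1n.
have cc : c / 2 <= c by rewrite ler_pdivrMr// ler_peMr ?ler1n// ltW.
exact: tri Is (ap s cs) (ap c cc).
Unshelve. all: by end_near. Qed.

End laplace_stieltjes.

(** * Integrating the Laplace transform against the Cauchy weight *)

Section stieltjes_limit.
Context {R : realType}.
Variables (a : R) (f : R -> R).
Hypothesis a_gt0 : 0 < a.
Local Notation mu := (@lebesgue_measure R).
Local Notation w := (cauchy_weight a).
Local Notation W := (cauchy_gauss a `[0, +oo[).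
Local Notation lower q := (cauchy_gauss a `[0, q]).
Local Notation upper q := (cauchy_gauss a `[q, +oo[).
Local Notation h := (fun t => f t * W t).
Hypothesis hI : improper_integrable 0^'+ +oo h.
Implicit Types (p q s t u v x y c d e T M : R).

Lemma lower_ratio_quasi_concave q u v : 0 <= q -> 0 <= u ->
  quasi_concave u v (fun t => lower q t / W t).
Proof.
move=> q0 u0; apply: nondecreasing_quasi_concave => s t us st tv.
exact: lower_ratio_nondecreasing (le_trans u0 us) st.
Qed.

Lemma lower_ratio_bound q u v : 0 <= q -> 0 < u ->
  forall t, u <= t -> t <= v -> 0 <= lower q t / W t <= 1.
Proof.
by move=> q0 u0 t ut _; apply: lower_ratio01 => //; exact: le_trans (ltW u0) ut.
Qed.

Lemma integrable_mul_lower q u v : 0 <= q -> 0 < u ->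
  mu.-integrable `[u, v] (EFin \o (fun t => f t * lower q t)).
Proof.
move=> q0 u0.
exact: (integrable_mul_kernel a f a_gt0 hI (lower q) 1 u v u0
  (lower_ratio_quasi_concave q u v q0 (ltW u0)) (lower_ratio_bound q u v q0 u0)).
Qed.

Lemma normr_Rintegral_mul_band p q e u v : 0 <= p -> p <= q -> 0 <= e -> 0 < u ->
  (forall x y, u <= x -> x <= y -> y <= v ->
    `|\int[mu]_(t in `[x, y]) h t| <= e) ->
  `|\int[mu]_(t in `[u, v]) (f t * (lower q t - lower p t))| <= 2 * e.
Proof.
move=> p0 pq e0 u0 he; have q0 := le_trans p0 pq.
have key r : 0 <= r -> `|\int[mu]_(t in `[u, v]) (f t * lower r t)| <= e.
  move=> r0; rewrite -[e]mul1r.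
  exact: (normr_Rintegral_mul_kernel a f a_gt0 hI (lower r) 1 e u v u0 ler01 e0
    (lower_ratio_quasi_concave r u v r0 (ltW u0)) (lower_ratio_bound r u v r0 u0) he).
have -> : \int[mu]_(t in `[u, v]) (f t * (lower q t - lower p t)) =
    \int[mu]_(t in `[u, v]) (f t * lower q t) -
    \int[mu]_(t in `[u, v]) (f t * lower p t).
  rewrite -RintegralB//; [|exact: integrable_mul_lower|exact: integrable_mul_lower].
  by apply: eq_Rintegral => t _; rewrite mulrBr.
by rewrite mulr_natl mulr2n (le_trans (ler_normB _ _))// lerD// key.
Qed.

Lemma integrable_mul_band p q u v : 0 <= p -> p <= q -> 0 < u ->
  mu.-integrable `[u, v] (EFin \o (fun t => f t * (lower q t - lower p t))).
Proof.
move=> p0 pq u0; have q0 := le_trans p0 pq.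
apply: eq_integrable (integrableB_EFin mu _ _ _ _
  (integrable_mul_lower q u v q0 u0) (integrable_mul_lower p u v p0 u0)) => //.
by move=> t _ /=; rewrite mulrBr.
Qed.

(** The share of the band [p, q] in W t differs from 1 by those of the frequencies
    below p and above q.  All these averages decrease with time, hence the time 0
    in the numerator and T in the denominator. *)
Lemma band_defect p q t T : 0 <= p -> p <= q -> 0 < t -> t <= T ->
  `|f t * (lower q t - lower p t) - h t| <=
  (lower p 0 + upper q 0) / W T * `|h t|.
Proof.
move=> p0 pq t0 tT; have q0 := le_trans p0 pq; have t0' := ltW t0.
have WT := cauchy_gauss_gt0 a a_gt0 T (le_trans t0' tT).
have Wd := cauchy_gauss_decr a a_gt0 `[0, +oo[ t T (measurable_itv _)
  (@subset_refl _ _) t0' tT.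
have Wt := lt_le_trans WT Wd.
have lp := cauchy_gauss_decr a a_gt0 `[0, p] 0 t (measurable_itv _)
  (itv_sub_ge0 _ _ (lexx 0)) (lexx 0) t0'.
have uq := cauchy_gauss_decr a a_gt0 `[q, +oo[ 0 t (measurable_itv _)
  (itv_sub_ge0 _ _ q0) (lexx 0) t0'.
have lp0 := cauchy_gauss_ge0 a a_gt0 `[0, p] t.
have uq0 := cauchy_gauss_ge0 a a_gt0 `[q, +oo[ t.
rewrite (cauchy_gauss_split a a_gt0 q t q0 t0') in Wd Wt *.
move: WT Wd Wt lp uq lp0 uq0.
move: (W T) (lower p t) (lower q t) (upper q t) (lower p 0) (upper q 0).
move=> wT lpt lqt uqt lp0 uq0 wT0 wTt wt0 lpl uql lpt0 uqt0.
have -> : f t * (lqt - lpt) - f t * (lqt + uqt) = - (f t * (lpt + uqt)) by ring.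
rewrite normrN !normrM (gtr0_norm wt0) (ger0_norm (addr_ge0 lpt0 uqt0)).
rewrite [leRHS]mulrCA ler_wpM2l// mulrAC ler_pdivlMr//.
by apply: ler_pM => //; [exact: addr_ge0|exact: ltW|exact: lerD].
Qed.

Lemma Rintegral_band x y p q : 0 < x -> 0 <= p -> p <= q ->
  \int[mu]_(s in `[p, q])
    (w s * \int[mu]_(t in `[x, y]) (f t * expR (- (s ^+ 2 * t)))) =
  \int[mu]_(t in `[x, y]) (f t * (lower q t - lower p t)).
Proof.
move=> x0 p0 pq.
pose K (z : R * R) := expR (- (z.1 ^+ 2 * z.2)).
have wi : mu.-integrable `[p, q] (EFin \o w).
  by apply: (integrableS _ _ _ (integrable_cauchy_weight a a_gt0)) => //; exact: itv_sub_ge0.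
have fi := integrable_f a f a_gt0 hI x y x0.
have K1 s t : `[p, q]%classic s -> `[x, y]%classic t -> `|K (s, t)| <= 1.
  rewrite /= !in_itv/= => _ /andP[xt _]; rewrite ger0_norm ?expR_ge0//.
  by apply: gauss_kernel_le1; exact: le_trans (ltW x0) xt.
have := Rintegral_bounded_kernel_swap mu mu _ _ _ _ _ 1 (measurable_itv _)
  (measurable_itv _) wi fi measurable_gauss_kernel K1.
move=> ->; apply: eq_Rintegral => t; rewrite inE/= in_itv/= => /andP[xt _].
by rewrite -(cauchy_gauss_band a a_gt0)// (le_trans (ltW x0)).
Qed.

Lemma laplace_sqr_continuous s : 0 < s ->
  {for s, continuous (fun s => w s * laplace f (s ^+ 2))}.
Proof.
move=> s0; apply: cvgM; first exact: continuous_cauchy_weight.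
apply: (@continuous_comp _ _ _ (fun s => s ^+ 2) (laplace f)).
  exact: exprn_continuous.
by apply: (laplace_continuous a) => //; exact: exprn_gt0.
Qed.

Lemma integrable_laplace_sqr p q : 0 < p ->
  mu.-integrable `[p, q] (EFin \o (fun s => w s * laplace f (s ^+ 2))).
Proof.
move=> p0; apply: continuous_compact_integrable; first exact: segment_compact.
apply: continuous_in_subspaceT => s; rewrite inE/= in_itv/= => /andP[ps _].
by apply: laplace_sqr_continuous; exact: lt_le_trans ps.
Qed.

Lemma integrable_truncated p q x y : 0 < p -> 0 < x ->
  mu.-integrable `[p, q] (EFin \o (fun s =>
    w s * \int[mu]_(t in `[x, y]) (f t * expR (- (s ^+ 2 * t))))).
Proof.
move=> p0 x0; apply: continuous_compact_integrable; first exact: segment_compact.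
apply: continuous_in_subspaceT => s; rewrite inE/= in_itv/= => /andP[ps _].
apply: cvgM; first exact: continuous_cauchy_weight.
apply: (@continuous_comp _ _ _ (fun s => s ^+ 2)
  (fun c => \int[mu]_(t in `[x, y]) (f t * expR (- (c * t))))).
  exact: exprn_continuous.
apply: (truncated_laplace_continuous a) => //.
by apply: exprn_gt0; exact: lt_le_trans ps.
Qed.

(** For fixed p and q the Laplace integral converges uniformly in s >= p, so it
    may be truncated before the integrals in s and t are exchanged. *)
Lemma stieltjes_truncation p q e : 0 < p -> p <= q -> 0 < e ->
  exists d T, 0 < d /\ forall x y, 0 < x -> x <= d -> T <= y ->
  `|\int[mu]_(s in `[p, q]) (w s * laplace f (s ^+ 2)) -
    \int[mu]_(t in `[x, y]) (f t * (lower q t - lower p t))| <= e.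
Proof.
move=> p0 pq e0.
have M0 : 0 < lower p 0 by exact: lower_mass_gt0.
(* The weight is at most 1 / a and the truncation error of the Laplace integral
   at most 2 e' / lower p 0; the 1 added to q - p keeps the denominator
   positive when p = q. *)
pose e' := lower p 0 * (a * e / (2 * (q - p + 1))).
have qp : 0 < q - p + 1 by rewrite ltr_wpDl// subr_ge0.
have e'0 : 0 < e' by rewrite mulr_gt0// divr_gt0// ?mulr_gt0.
have [d [T hdT]] := improper_integrable_small_tails _ hI _ e'0.
have [d0 dT _ _] := hdT.
exists d, T; split=> // x y x0 xd Ty.
rewrite -(Rintegral_band x y p q x0 (ltW p0) pq) -RintegralB//; last 2 first.
- exact: integrable_laplace_sqr.
- exact: integrable_truncated.
apply: le_trans (_ : a^-1 * (2 * ((lower p 0)^-1 * e')) * (q - p) <= _); last first.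
  rewrite /e' mulKf ?gt_eqF//.
  have -> : a^-1 * (2 * (a * e / (2 * (q - p + 1)))) * (q - p) = e * ((q - p) / (q - p + 1)).
    by field; rewrite !gt_eqF.
  by rewrite ler_piMr ?(ltW e0)// ler_pdivrMr// mul1r lerDl ler01.
apply: normr_Rintegral_itv_le => //.
  apply: integrableB_EFin => //; first exact: integrable_laplace_sqr.
  exact: integrable_truncated.
move=> s ps sq; rewrite -mulrBr normrM ler_pM//.
  by rewrite ger0_norm ?cauchy_weight_ge0// cauchy_weight_le.
rewrite distrC; apply: (laplace_approx a f a_gt0 hI p _ e' d T) => //.
  by rewrite ler_sqr ?nnegrE ?(ltW p0)// (le_trans (ltW p0)).
exact: ltW.
Qed.

(** The truncated integral over [x, y] is cut at d and T.  On [x, d] and [T, y]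
    the second mean value estimate gives bounds that do not involve p and q; on
    the fixed interval [d, T] the share of the band [p, q] is close to 1. *)
Lemma stieltjes_approx e : 0 < e ->
  exists d T, 0 < d /\ forall p q, 0 < p -> p <= d -> T <= q ->
  `|\int[mu]_(s in `[p, q]) (w s * laplace f (s ^+ 2)) -
    improper_integral 0^'+ +oo h| <= e.
Proof.
(* The error e is spent as 1/8 for the truncation, 2/8 for each of [x, d] and
   [T, y], 1/8 for the band on [d, T], and 2/8 for the tails of h. *)
move=> e0; have e80 : 0 < e / 8 by rewrite divr_gt0.
have [d [T hdT]] := improper_integrable_small_tails _ hI _ e80.
have [d0 dT h0 hy] := hdT.
have T0 := lt_le_trans d0 dT.
have hi := improper_integrable_compact _ hI.
pose C := \int[mu]_(t in `[d, T]) `|h t|.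
have C0 : 0 <= C by apply: Rintegral_ge0.
have WT : 0 < W T by apply: cauchy_gauss_gt0 => //; exact: ltW.
(* eta bounds the masses below p and above q, so that their shares, of total at
   most 2 eta / W T, change the integral over [d, T] by at most e / 8. *)
pose eta := e / 8 * W T / (2 * (C + 1)).
have C1 : 0 < C + 1 by rewrite ltr_wpDl.
have eta0 : 0 < eta by rewrite divr_gt0 ?mulr_gt0.
have [q0 [q00 Hq]] : exists q0, 0 <= q0 /\ forall q, q0 <= q -> upper q 0 <= eta.
  have cv : atan (q / a) @[q --> +oo] --> pi / 2.
    apply: (cvg_comp (fun q => q / a) atan); last exact: cvgy_atan.
    under eq_fun do rewrite mulrC.
    have ia0 : 0 < a^-1 by rewrite invr_gt0.
    exact: (gt0_cvgMry ia0 (@cvg_id _ (pinfty_nbhs R))).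
  have /cvgrPdist_le/(_ _ eta0) [q1 [_ H]] := cv.
  exists (Num.max 0 (q1 + 1)); split; first by rewrite le_max lexx.
  move=> q; rewrite ge_max => /andP[_ qq]; rewrite upper_mass//.
  apply: le_trans (ler_norm _) _; apply: H.
  by rewrite (lt_le_trans _ qq)// ltrDl.
exists (a * eta), (Num.max q0 (a * eta)); split; first exact: mulr_gt0.
move=> p q p0 pd; rewrite ge_max => /andP[q0q dq].
have pq : p <= q := le_trans pd dq.
have defect : (lower p 0 + upper q 0) / W T * C <= e / 8.
  have lp : lower p 0 <= eta.
    apply: le_trans (lower_mass_le a a_gt0 p (ltW p0)) _.
    by rewrite ler_pdivrMr// mulrC.
  apply: le_trans (_ : 2 * eta / W T * C <= _).
    rewrite ler_wpM2r// ler_wpM2r ?invr_ge0 ?(ltW WT)//.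
    by rewrite mulr_natl mulr2n lerD// Hq.
  rewrite /eta.
  have -> : 2 * (e / 8 * W T / (2 * (C + 1))) / W T * C = e / 8 * (C / (C + 1)).
    by field; rewrite !gt_eqF.
  by rewrite ler_piMr ?(ltW e80)// ler_pdivrMr// mul1r lerDl ler01.
have [d' [T' [d'0 trunc]]] := stieltjes_truncation p q _ p0 pq e80.
pose x := Num.min d d'; pose y := Num.max T T'.
have x0 : 0 < x by rewrite lt_min d0.
have xd : x <= d by rewrite ge_min lexx.
have Ty : T <= y by rewrite le_max lexx.
have {trunc} := trunc x y x0 _ _.
rewrite ge_min lexx orbT le_max lexx orbT => /(_ isT isT).
have bi u v : 0 < u -> _ := integrable_mul_band p q u v (ltW p0) pq.
rewrite (Rintegral_itv_cat _ x d y)//; last 2 first.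
- exact: le_trans Ty.
- exact: bi.
rewrite (Rintegral_itv_cat _ d T y)//; last exact: bi.
have lo : `|\int[mu]_(t in `[x, d]) (f t * (lower q t - lower p t))| <= 2 * (e / 8).
  apply: normr_Rintegral_mul_band => //; [exact: ltW|exact: ltW|].
  by move=> u v xu uv vd; apply: h0 => //; exact: lt_le_trans xu.
have up : `|\int[mu]_(t in `[T, y]) (f t * (lower q t - lower p t))| <= 2 * (e / 8).
  apply: normr_Rintegral_mul_band => //; [exact: ltW|exact: ltW|].
  by move=> u v Tu uv _; exact: hy.
have mid : `|\int[mu]_(t in `[d, T]) (f t * (lower q t - lower p t)) -
    \int[mu]_(t in `[d, T]) h t| <= e / 8.
  apply: le_trans defect.
  rewrite -RintegralB//; [|exact: bi|exact: hi].
  have di : mu.-integrable `[d, T]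
      (EFin \o (fun t => f t * (lower q t - lower p t) - h t)).
    by apply: integrableB_EFin => //; [exact: bi|exact: hi].
  rewrite (le_trans (le_normr_Rintegral _ di))//.
  rewrite /C -RintegralZl//; last exact/integrable_norm/hi.
  apply: le_Rintegral => //.
  - exact: integrable_norm di.
  - by apply: (integrableZl _ _ (integrable_norm (hi d T d0))).
  move=> t; rewrite /= in_itv/= => /andP[dt tT].
  by apply: band_defect => //; [exact: ltW|exact: lt_le_trans dt].
have near_L := small_tails_improper_integral h (e / 8) d T d T hI hdT d0 (lexx _) (lexx _).
move: lo up mid near_L.
move: (\int[mu]_(t in `[x, d]) _) (\int[mu]_(t in `[T, y]) _).
move: (\int[mu]_(t in `[d, T]) (f t * (_ - _))) (\int[mu]_(t in `[d, T]) h t).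
move: (improper_integral _ _ _) (\int[mu]_(s in _) _) => L J I2 H I1 I3.
rewrite !ler_norml => /andP[? ?] /andP[? ?] /andP[? ?] /andP[? ?] /andP[? ?].
by apply/andP; split; lra.
Qed.

Lemma stieltjes_limit :
  improper_integrable 0^'+ +oo (fun s => w s * laplace f (s ^+ 2)) /\
  improper_integral 0^'+ +oo (fun s => w s * laplace f (s ^+ 2)) =
  improper_integral 0^'+ +oo h.
Proof.
apply: improper_integral_of_approx; last exact: stieltjes_approx.
by move=> p q; exact: integrable_laplace_sqr.
Qed.

End stieltjes_limit.

(** * The angular variable and the conclusion *)

Section angular_variable.
Context {R : realType}.
Variables (a : R) (Phi : R -> R).
Hypothesis a_gt0 : 0 < a.
Hypothesis Phi_cont : forall c, 0 < c -> {for c, continuous Phi}.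
Local Notation mu := (@lebesgue_measure R).
Implicit Types (p q s x y e L : R).

Lemma pihalf_gt0 : 0 < pi / 2 :> R.
Proof. by rewrite divr_gt0// pi_gt0. Qed.

Lemma pihalf_itv x : 0 <= x -> x < pi / 2 -> x \in `](- (pi / 2)), (pi / 2)[.
Proof.
move=> x0 xp; rewrite in_itv/= xp andbT (lt_le_trans _ x0)//.
by rewrite oppr_lt0 pihalf_gt0.
Qed.

Lemma tan_gt0 x : 0 < x -> x < pi / 2 -> 0 < tan x.
Proof.
move=> x0 xp; rewrite -tan0 ltr_tan// pihalf_itv ?pihalf_gt0//.
exact: ltW.
Qed.

Lemma atan_tan_scaled x : 0 < x -> x < pi / 2 -> atan (a * tan x / a) = x.
Proof.
by move=> x0 xp; rewrite mulrAC divff ?gt_eqF// mul1r tanK// pihalf_itv// ltW.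
Qed.

Lemma continuous_angular x : 0 < x -> x < pi / 2 ->
  {for x, continuous (fun theta => Phi (a ^+ 2 * tan theta ^+ 2))}.
Proof.
move=> x0 xp.
have cx : 0 < cos x.
  by rewrite cos_gt0_pihalf// xp andbT (lt_trans _ x0)// oppr_lt0 pihalf_gt0.
apply: (@continuous_comp _ _ _ (fun x => a ^+ 2 * tan x ^+ 2) Phi); last first.
  by apply: Phi_cont; rewrite mulr_gt0// exprn_gt0// tan_gt0.
apply: cvgM; first exact: cvg_cst.
apply: (@continuous_comp _ _ _ tan (fun x => x ^+ 2)); last exact: exprn_continuous.
by apply: continuous_tan; rewrite gt_eqF.
Qed.

Lemma within_continuous_angular x y : 0 < x -> y < pi / 2 ->
  {within `[x, y], continuous (fun theta => Phi (a ^+ 2 * tan theta ^+ 2))}.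
Proof.
move=> x0 yp; apply: continuous_in_subspaceT => z.
rewrite inE/= in_itv/= => /andP[xz zy]; apply: continuous_angular.
  exact: lt_le_trans xz.
exact: le_lt_trans yp.
Qed.

(** The change of variable theta = atan (s / a), whose derivative is the weight.
    It is made on compact intervals, where the integrand is continuous. *)
Lemma angular_substitution x y : 0 < x -> x <= y -> y < pi / 2 ->
  \int[mu]_(theta in `[x, y]) Phi (a ^+ 2 * tan theta ^+ 2) =
  \int[mu]_(s in `[a * tan x, a * tan y]) (cauchy_weight a s * Phi (s ^+ 2)).
Proof.
move=> x0 xy yp; pose F s := atan (s / a).
have y0 := lt_le_trans x0 xy; have xp := le_lt_trans xy yp.
have Fx : F (a * tan x) = x by rewrite /F atan_tan_scaled.
have Fy : F (a * tan y) = y by rewrite /F atan_tan_scaled.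
have dF : derive1 F = cauchy_weight a.
  by apply/funext => s; rewrite derive1E;
  exact: (@derive_val _ _ _ _ _ _ _ (is_derive_atan_scaled a a_gt0 s)).
have cF s : continuous_at s F.
  apply/differentiable_continuous/derivable1_diffP.
  by have [] := is_derive_atan_scaled a a_gt0 s.
have pq : a * tan x <= a * tan y.
  rewrite ler_pM2l//; move: xy; rewrite le_eqVlt => /predU1P[->//|xy].
  by rewrite ltW// ltr_tan// pihalf_itv// ltW.
have := @integration_by_substitution_increasing R F
  (fun theta => Phi (a ^+ 2 * tan theta ^+ 2)) _ _ pq.
rewrite dF Fx Fy => H; rewrite /Rintegral H.
- congr fine; apply: eq_integral => s _ /=; congr EFin.
  rewrite mulrC; congr (_ * Phi _).
  by rewrite /F atanK exprMn exprVn mulrC divfK// expf_neq0// gt_eqF.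
- by move=> u v _ _ uv; apply: lt_atan; rewrite ltr_pM2r// invr_gt0.
- by move=> s _; exact: continuous_cauchy_weight.
- by apply/cvg_ex; eexists; apply: cvg_at_right_filter; exact: continuous_cauchy_weight.
- by apply/cvg_ex; eexists; apply: cvg_at_left_filter; exact: continuous_cauchy_weight.
- split.
  + by move=> s _; have [] := is_derive_atan_scaled a a_gt0 s.
  + by apply: cvg_at_right_filter; exact: cF.
  + by apply: cvg_at_left_filter; exact: cF.
- exact: within_continuous_angular.
Qed.

Lemma improper_integral_angular :
  improper_integrable 0^'+ +oo (fun s => cauchy_weight a s * Phi (s ^+ 2)) ->
  improper_integrable 0^'+ (pi / 2)^'- (fun theta => Phi (a ^+ 2 * tan theta ^+ 2)) /\
  improper_integral 0^'+ (pi / 2)^'- (fun theta => Phi (a ^+ 2 * tan theta ^+ 2)) =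
  improper_integral 0^'+ +oo (fun s => cauchy_weight a s * Phi (s ^+ 2)).
Proof.
move=> sI; set G := (fun theta => Phi _); set L' := improper_integral 0^'+ +oo _.
have approx e : 0 < e -> \forall p \near filter_prod (0 : R)^'+ (pi / 2)^'-,
    `|L' - compact_integral G p| <= e.
  move=> e0; have [d [T [d0 H]]] := improper_integral_approx _ e sI e0.
  have da0 : 0 < d / a by rewrite divr_gt0.
  pose x1 := Num.min (atan (d / a)) (pi / 4).
  pose y1 := Num.max (atan (T / a)) (pi / 4).
  have p4 : pi / 4 < pi / 2 :> R by have := pi_gt0 R; lra.
  have p40 : 0 < pi / 4 :> R by have := pi_gt0 R; lra.
  have x10 : 0 < x1 by rewrite lt_min p40 andbT -atan0; exact: lt_atan.
  have y1p : y1 < pi / 2 by rewrite gt_max p4 andbT; exact: atan_ltpi2.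
  exists ([set x | 0 < x <= x1], [set y | y1 <= y < pi / 2]) => /=.
    split; near=> z => /=; apply/andP; split; near: z.
    - exact: nbhs_right_gt.
    - exact: nbhs_right_le.
    - exact: nbhs_left_ge.
    - exact: nbhs_left_lt.
  move=> [x y] /= [/andP[x0 xx1] /andP[yy1 yp]].
  (* The value pi / 4 only serves to keep x below y. *)
  have x1y1 : x1 <= y1 
    by apply: (@le_trans _ _ (pi / 4)); rewrite ?ge_min ?le_max lexx orbT.
  have xy : x <= y by rewrite (le_trans xx1)// (le_trans x1y1).
  have xp := le_lt_trans xy yp; have y0 := lt_le_trans x0 xy.
  rewrite /compact_integral/= distrC angular_substitution//; apply: H.
  - by rewrite mulr_gt0// tan_gt0.
  - rewrite mulrC -ler_pdivlMr// leNgt; apply/negP => /lt_atan.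
    rewrite tanK ?pihalf_itv ?(ltW x0)//.
    by apply/negP; rewrite -leNgt (le_trans xx1)// ge_min lexx.
  - rewrite mulrC -ler_pdivrMr// leNgt; apply/negP => /lt_atan.
    rewrite tanK ?pihalf_itv ?(ltW y0)//.
    by apply/negP; rewrite -leNgt (le_trans _ yy1)// le_max lexx.
have cv : compact_integral G p @[p --> filter_prod (0 : R)^'+ (pi / 2)^'-] --> L'.
  exact/cvgrPdist_le.
split; last exact/cvg_lim.
split; last by apply/cvg_ex; exists L'.
exists ([set x | 0 < x], [set y | y < pi / 2]) => /=.
  by split; [exact: nbhs_right_gt|exact: nbhs_left_lt].
move=> [x y] /= [x0 yp]; apply: continuous_compact_integrable.
  exact: segment_compact.
exact: within_continuous_angular.
Unshelve. all: by end_near. Qed.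

End angular_variable.

Lemma improper_integral_scale {R : realType} (c : R) (g1 g2 : R -> R) :
  (forall t : R, 0 < t -> g1 t = c * g2 t) -> improper_integrable 0^'+ +oo g2 ->
  improper_integrable 0^'+ +oo g1 /\
  improper_integral 0^'+ +oo g1 = c * improper_integral 0^'+ +oo g2.
Proof.
move=> g12 g2I; have g2i := improper_integrable_compact _ g2I.
have pos (x y t : R) : 0 < x -> t \in `[x, y]%classic -> 0 < t.
  by move=> x0; rewrite inE/= in_itv/= => /andP[xt _]; exact: lt_le_trans xt.
apply: improper_integral_of_approx => [x y x0|e e0].
  apply: eq_integrable (integrableZl _ c (g2i x y x0)) => // t txy /=.
  by rewrite g12// (pos x y).
have c1 : 0 < `|c| + 1 by rewrite ltr_wpDl.
have e'0 : 0 < e / (`|c| + 1) by rewrite divr_gt0.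
have [d [T [d0 H]]] := improper_integral_approx _ _ g2I e'0.
exists d, T; split=> // x y x0 xd Ty.
have -> : \int[lebesgue_measure]_(t in `[x, y]) g1 t =
    c * \int[lebesgue_measure]_(t in `[x, y]) g2 t.
  rewrite -RintegralZl//; last exact: g2i.
  by apply: eq_Rintegral => t txy; rewrite g12// (pos x y).
rewrite -mulrBr normrM (le_trans (ler_wpM2l _ (H x y x0 xd Ty)))//.
by rewrite mulrCA ler_piMr ?(ltW e0)// ler_pdivrMr// mul1r lerDl ler01.
Qed.

Theorem lemma2p11 (R : realType) (a : R) (f : R -> R) (a_gt0 : 0 < a)
  (lhs_cvg : improper_integrable 0^'+ +oo
     (fun t => expR (a ^+ 2 * t) * f t * erfc (a * Num.sqrt t))) :
  [/\ (forall s : R, 0 < s ->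
         improper_integrable 0^'+ +oo (fun t => f t * expR (- (s * t)))),
      improper_integrable 0^'+ (pi / 2)^'-
        (fun theta => laplace f (a ^+ 2 * tan theta ^+ 2)),
      improper_integrable 0^'+ +oo
        (fun s => laplace f (s ^+ 2) / (s ^+ 2 + a ^+ 2)),
      improper_integral 0^'+ +oo
        (fun t => expR (a ^+ 2 * t) * f t * erfc (a * Num.sqrt t))
      = 2 / pi * improper_integral 0^'+ (pi / 2)^'-
          (fun theta => laplace f (a ^+ 2 * tan theta ^+ 2)) &
      2 / pi * improper_integral 0^'+ (pi / 2)^'-
          (fun theta => laplace f (a ^+ 2 * tan theta ^+ 2))
      = 2 * a / pi * improper_integral 0^'+ +oo
          (fun s => laplace f (s ^+ 2) / (s ^+ 2 + a ^+ 2))].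
Proof.
have pi0 : pi != 0 :> R by rewrite gt_eqF// pi_gt0.
have an0 : a != 0 by rewrite gt_eqF.
have hE0 t : 0 < t -> f t * cauchy_gauss a `[0, +oo[ t =
    pi / 2 * (expR (a ^+ 2 * t) * f t * erfc (a * Num.sqrt t)).
  by move=> t0; rewrite cauchy_gauss_erfc//; ring.
have [hI hE] := improper_integral_scale _ _ _ hE0 lhs_cvg.
have [sI sE] := stieltjes_limit a f a_gt0 hI.
have [tI tE] := improper_integral_angular a (laplace f) a_gt0
  (laplace_continuous a f a_gt0 hI) sI.
have rE0 s : 0 < s -> laplace f (s ^+ 2) / (s ^+ 2 + a ^+ 2) =
    a^-1 * (cauchy_weight a s * laplace f (s ^+ 2)).
  by move=> _; move: (laplace _ _) => F; rewrite /cauchy_weight -mulrA mulKf// mulrC.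
have [rI rE] := improper_integral_scale _ _ _ rE0 sI.
split; [exact: (laplace_integrable a f a_gt0 hI)|exact: tI|exact: rI| |].
- rewrite tE sE hE; move: pi pi0 (improper_integral _ _ _) => P P0 L.
  by field.
- rewrite rE tE; move: pi pi0 (improper_integral _ _ _) => P P0 L.
  by field; rewrite an0 P0.
Qed.
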